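(* Let $(\mathcal{A},\mathcal{B},\mathfrak{F},d,\tau)$ be the canonical fusion bialgebra associated with the Grothendieck ring $\mathcal{R}$ of a unitary fusion category $\mathscr{C}$. Then the Schur product property holds on $\mathcal{B}$ (the dual of the fusion ring $\mathcal{R}$): $x*_{\mathcal{B}}y\ge0$ for all $x,y\ge0$ in $\mathcal{B}$.
   Context: Let $x_1=1,x_2,\dots,x_m$ be the classes of the simple objects of $\mathscr{C}$ in its Grothendieck ring $\mathcal{R}$, with $x_jx_k=\sum_sN_{j,k}^sx_s$ and duality $x_j\mapsto x_{j^*}$. The associated canonical fusion bialgebra is defined as follows. $\mathcal{B}=\mathcal{R}\otimes_{\mathbb{Z}}\mathbb{C}$ with this multiplication and the anti-linear involution $x_j^*=x_{j^*}$, with faithful tracial state $\tau(x_j)=\delta_{j,1}$; it is a $C^*$-algebra via left multiplication on $L^2(\mathcal{B},\tau)$ (in which $\{x_j\}$ is orthonormal). $d$ is the linear functional with $d(x_j)$ equal to the operator norm of left multiplication by $x_j$ (the Frobenius-Perron dimension). $\mathcal{A}$ is the commutative $C^*$-algebra with linear basis $\{x_1,\dots,x_m\}$, multiplication $x_j\diamond x_k=\delta_{j,k}d(x_j)^{-1}x_j$, anti-linear involution $x_j^{\#}=x_j$ and trace $d$. $\mathfrak{F}:\mathcal{A}\to\mathcal{B}$ is the linear map $\mathfrak{F}(x_j)=x_j$. The convolution on $\mathcal{B}$ is $x*_{\mathcal{B}}y:=\big(\mathfrak{F}(\mathfrak{F}^{-1}(y^* )\diamond\mathfrak{F}^{-1}(x^*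 ))\big)^*$; positivity in $\mathcal{B}$ is in the sense of $C^*$-algebras. *)

(* Defs.v *)
(* The complex numbers are R[i], with R : realType. *)
From HB Require Import structures.
From mathcomp Require Import all_boot all_order all_algebra.
From mathcomp Require Import classical_sets reals.
From mathcomp Require Import complex.
Set Implicit Arguments.
Unset Strict Implicit.
Unset Printing Implicit Defensive.
Import Order.TTheory GRing.Theory Num.Theory.
Local Open Scope ring_scope.

Record linearCategory (R : realType) := LinearCategory {
  ob :> Type;
  hom : ob -> ob -> vectType (R[i])%C;
  idm : forall a : ob, hom a a;
  mcomp : forall a b c : ob, hom b c -> hom a b -> hom a c;
  mcomp1m : forall (a b : ob) (f : hom a b), mcomp (idm b) f = f;
  mcompm1 : forall (a b : ob) (f : hom a b), mcomp f (idm a) = f;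
  mcompA : forall (a b c d : ob) (h : hom c d) (g : hom b c) (f : hom a b),
    mcomp h (mcomp g f) = mcomp (mcomp h g) f;
  mcomp_linear_l : forall (a b c : ob) (f : hom a b),
    linear (fun g : hom b c => mcomp g f);
  mcomp_linear_r : forall (a b c : ob) (g : hom b c),
    linear (fun f : hom a b => mcomp g f) }.

Arguments hom {R l} a b.
Arguments idm {R l} a.
Arguments mcomp {R l a b c} g f.

Notation "g '\oc' f" := (mcomp g f) (at level 50, left associativity).

Section CategoryNotions.
Variables (R : realType) (C : linearCategory R).

Definition is_iso (a b : C) (f : hom a b) : Prop :=
  exists g : hom b a, g \oc f = idm a /\ f \oc g = idm b.

Definition isomorphic (a b : C) : Prop := exists f : hom a b, is_iso f.

Definition monic (a b : C) (f : hom a b) : Prop :=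
  forall (c : C) (g h : hom c a), f \oc g = f \oc h -> g = h.

Definition epic (a b : C) (f : hom a b) : Prop :=
  forall (c : C) (g h : hom b c), g \oc f = h \oc f -> g = h.

Definition is_kernel (a b c : C) (f : hom a b) (k : hom c a) : Prop :=
  f \oc k = 0 /\
  forall (d : C) (h : hom d a), f \oc h = 0 ->
    exists! u : hom d c, k \oc u = h.

Definition is_cokernel (a b c : C) (f : hom a b) (q : hom b c) : Prop :=
  q \oc f = 0 /\
  forall (d : C) (h : hom b d), h \oc f = 0 ->
    exists! u : hom c d, u \oc q = h.

(* X is a direct sum (biproduct) of the finite family F; for an empty index
   type this says that X is a zero object. *)
Definition is_direct_sum (I : finType) (F : I -> C) (X : C) : Prop :=
  exists (inj : forall i : I, hom (F i) X) (proj : forall i : I, hom X (F i)),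
    [/\ forall i, proj i \oc inj i = idm (F i),
        forall i j, i != j -> proj i \oc inj j = 0
      & \sum_(i : I) (inj i \oc proj i) = idm X].

Definition abelian_category : Prop :=
  [/\ forall (n : nat) (F : 'I_n -> C), exists X : C, is_direct_sum F X,
      forall (a b : C) (f : hom a b), exists (c : C) (k : hom c a),
        is_kernel f k,
      forall (a b : C) (f : hom a b), exists (c : C) (q : hom b c),
        is_cokernel f q,
      forall (a b : C) (f : hom a b), monic f ->
        exists (c : C) (g : hom b c), is_kernel g f
    & forall (a b : C) (f : hom a b), epic f ->
        exists (c : C) (g : hom c a), is_cokernel g f].

Definition simple_object (X : C) : Prop :=
  idm X != 0 /\
  forall (Y : C) (f : hom Y X), monic f -> f = 0 \/ is_iso f.

Definition semisimple_category : Prop :=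
  forall X : C, exists (n : nat) (F : 'I_n -> C),
    (forall i, simple_object (F i)) /\ is_direct_sum F X.

Definition finitely_many_simples : Prop :=
  exists (n : nat) (F : 'I_n -> C),
    forall X : C, simple_object X -> exists i, isomorphic X (F i).

Definition simple_classes (m : nat) (S : 'I_m -> C) : Prop :=
  [/\ forall i, simple_object (S i),
      forall i j, isomorphic (S i) (S j) -> i = j
    & forall X : C, simple_object X -> exists i, isomorphic X (S i)].

End CategoryNotions.

Record monoidalStructure (R : realType) (C : linearCategory R) :=
  MonoidalStructure {
  tens : C -> C -> C;
  tunit : C;
  tensm : forall a b a' b' : C,
    hom a a' -> hom b b' -> hom (tens a b) (tens a' b');
  tensm1 : forall a b : C, tensm (idm a) (idm b) = idm (tens a b);
  tensm_comp : forall (a b a' b' a'' b'' : C)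
    (f' : hom a' a'') (f : hom a a') (g' : hom b' b'') (g : hom b b'),
    tensm (f' \oc f) (g' \oc g) = tensm f' g' \oc tensm f g;
  tensm_linear_l : forall (a b a' b' : C) (g : hom b b'),
    linear (fun f : hom a a' => tensm f g);
  tensm_linear_r : forall (a b a' b' : C) (f : hom a a'),
    linear (fun g : hom b b' => tensm f g);
  associator : forall a b c : C, hom (tens (tens a b) c) (tens a (tens b c));
  lunit : forall a : C, hom (tens tunit a) a;
  runit : forall a : C, hom (tens a tunit) a;
  assoc_iso : forall a b c : C, is_iso (associator a b c);
  lunit_iso : forall a : C, is_iso (lunit a);
  runit_iso : forall a : C, is_iso (runit a);
  assoc_nat : forall (a b c a' b' c' : C)
    (f : hom a a') (g : hom b b') (h : hom c c'),
    associator a' b' c' \oc tensm (tensm f g) h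
    = tensm f (tensm g h) \oc associator a b c;
  lunit_nat : forall (a a' : C) (f : hom a a'),
    lunit a' \oc tensm (idm tunit) f = f \oc lunit a;
  runit_nat : forall (a a' : C) (f : hom a a'),
    runit a' \oc tensm f (idm tunit) = f \oc runit a;
  pentagon : forall a b c d : C,
    associator a b (tens c d) \oc associator (tens a b) c d
    = tensm (idm a) (associator b c d) \oc associator a (tens b c) d
        \oc tensm (associator a b c) (idm d);
  triangle : forall a b : C,
    tensm (idm a) (lunit b) \oc associator a tunit b = tensm (runit a) (idm b) }.

Arguments tens {R C} m a b.
Arguments tunit {R C} m.
Arguments tensm {R C} m {a b a' b'} f g.
Arguments associator {R C} m a b c.
Arguments lunit {R C} m a.
Arguments runit {R C} m a.

Section Duality.
Variables (R : realType) (C : linearCategory R) (M : monoidalStructure C).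

(* Snake identities: the unitor entering each of the two composites has been
   moved to the right-hand side. *)
Definition is_left_dual (X Xd : C) : Prop :=
  exists (ev : hom (tens M Xd X) (tunit M)) (coev : hom (tunit M) (tens M X Xd))
         (associator_inv : hom (tens M Xd (tens M X Xd)) (tens M (tens M Xd X) Xd)),
    [/\ associator_inv \oc associator M Xd X Xd = idm _,
        associator M Xd X Xd \oc associator_inv = idm _,
        runit M X \oc tensm M (idm X) ev \oc associator M X Xd X
          \oc tensm M coev (idm X) = lunit M X
      & lunit M Xd \oc tensm M ev (idm Xd) \oc associator_inv
          \oc tensm M (idm Xd) coev = runit M Xd].

Definition rigid : Prop :=
  forall X : C, (exists Y : C, is_left_dual X Y) /\
                (exists Z : C, is_left_dual Z X).

End Duality.

(* C*-category structure. Completeness of the norms is automatic, the hom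
   spaces being finite-dimensional; the last axiom says that dag f \oc f is a
   positive element of the C*-algebra hom a a. *)
Record starStructure (R : realType) (C : linearCategory R) :=
  StarStructure {
  dag : forall a b : C, hom a b -> hom b a;
  dagK : forall (a b : C) (f : hom a b), dag (dag f) = f;
  dag_comp : forall (a b c : C) (g : hom b c) (f : hom a b),
    dag (g \oc f) = dag f \oc dag g;
  dag_antilinear : forall (a b : C) (k : (R[i])%C) (f g : hom a b),
    dag (k *: f + g) = k^* *: dag f + dag g;
  cnorm : forall a b : C, hom a b -> R;
  cnorm_eq0 : forall (a b : C) (f : hom a b), cnorm f = 0 -> f = 0;
  cnormD : forall (a b : C) (f g : hom a b),
    cnorm (f + g) <= cnorm f + cnorm g;
  cnormZ : forall (a b : C) (k : (R[i])%C) (f : hom a b),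
    ((cnorm (k *: f))%:C)%C = `|k| * ((cnorm f)%:C)%C;
  cnorm_comp : forall (a b c : C) (g : hom b c) (f : hom a b),
    cnorm (g \oc f) <= cnorm g * cnorm f;
  cnorm_cstar : forall (a b : C) (f : hom a b),
    cnorm (dag f \oc f) = cnorm f ^+ 2;
  dag_pos : forall (a b : C) (f : hom a b),
    exists g : hom a a, dag f \oc f = dag g \oc g }.

Arguments dag {R C} s {a b} f.

Definition unitary (R : realType) (C : linearCategory R)
    (D : starStructure C) (a b : C) (u : hom a b) : Prop :=
  dag D u \oc u = idm a /\ u \oc dag D u = idm b.

Record unitaryFusionCategory (R : realType) := UnitaryFusionCategory {
  ufc_cat :> linearCategory R;
  ufc_tens : monoidalStructure ufc_cat;
  ufc_star : starStructure ufc_cat;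
  ufc_abelian : abelian_category ufc_cat;
  ufc_semisimple : semisimple_category ufc_cat;
  ufc_finite : finitely_many_simples ufc_cat;
  ufc_rigid : rigid ufc_tens;
  ufc_unit : \dim {:hom (tunit ufc_tens) (tunit ufc_tens)}%VS = 1%N;
  ufc_dag_tens : forall (a b a' b' : ufc_cat) (f : hom a a') (g : hom b b'),
    dag ufc_star (tensm ufc_tens f g)
    = tensm ufc_tens (dag ufc_star f) (dag ufc_star g);
  ufc_assoc : forall a b c : ufc_cat,
    unitary ufc_star (associator ufc_tens a b c);
  ufc_lunit : forall a : ufc_cat, unitary ufc_star (lunit ufc_tens a);
  ufc_runit : forall a : ufc_cat, unitary ufc_star (runit ufc_tens a) }.

(* Structure constants of a fusion ring with basis x_j, j : 'I_m.+1, where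
   x_ord0 is the unit: x_j x_k = \sum_s fcoef j k s x_s and x_j^* = x_(fdual j) *)
Record fusionData (m : nat) := FusionData {
  fcoef : 'I_m.+1 -> 'I_m.+1 -> 'I_m.+1 -> nat;
  fdual : 'I_m.+1 -> 'I_m.+1 }.

(* In the semisimple category C, the identity [S j][S k] = \sum_s N j k s [S s]
   of the Grothendieck ring means that tens (S j) (S k) is a direct sum of
   N j k s copies of S s, s ranging over all the simple classes. *)
Record is_grothendieck_ring (R : realType) (C : unitaryFusionCategory R)
    (m : nat) (S : 'I_m.+1 -> C) (G : fusionData m) : Prop := {
  gr_classes : simple_classes S;
  gr_unit : isomorphic (S ord0) (tunit (ufc_tens C));
  gr_coef : forall j k : 'I_m.+1,
    is_direct_sum (fun p : {s : 'I_m.+1 & 'I_(fcoef G j k s)} => S (tag p))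
                  (tens (ufc_tens C) (S j) (S k));
  gr_dual : forall j : 'I_m.+1,
    is_left_dual (ufc_tens C) (S j) (S (fdual G j)) }.

(* Both algebras of the canonical fusion bialgebra are carried by row vectors
   of complex coordinates in the basis x_j. *)
Section FusionBialgebra.
Variables (R : realType) (m : nat) (G : fusionData m).
Let V := 'rV[(R[i])%C]_m.+1.
Implicit Types x y z : 'rV[(R[i])%C]_m.+1.

Definition fbasis (j : 'I_m.+1) : V := delta_mx 0 j.

Definition mulB x y : V :=
  \row_s \sum_j \sum_k x 0 j * y 0 k * (fcoef G j k s)%:R.

Definition starB x : V := \row_s \sum_(j | fdual G j == s) (x 0 j)^*.

Definition tauB x : (R[i])%C := x 0 ord0.

Definition posB x : Prop := exists z, x = mulB (starB z) z.

Definition normL2 x : R := Num.sqrt (complex.Re (tauB (mulB (starB x) x))).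

Definition opnorm x : R :=
  sup [set normL2 (mulB x y) | y in [set y : V | normL2 y <= 1]]%classic.

(* The Frobenius-Perron dimension, extended linearly; also the trace of A. *)
Definition fpdim x : (R[i])%C :=
  \sum_j x 0 j * ((opnorm (fbasis j))%:C)%C.

Definition mulA x y : V :=
  \row_j ((fpdim (fbasis j))^-1 * (x 0 j * y 0 j)).

(* The Fourier transform A -> B, x_j |-> x_j, and its inverse B -> A are the
   identity in coordinates. *)
Definition fourier x : V := x.
Definition fourier_inv x : V := x.

Definition convB x y : V :=
  starB (fourier (mulA (fourier_inv (starB y)) (fourier_inv (starB x)))).

End FusionBialgebra.

(* Main.v *)
(* Write x_j, d_j and N_{jk}^s for the basis, the dimensions and the structure
   constants.  In coordinates (x * y)_s = x_s y_s / d_s, so for x = a a^* and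
   y = b^* b the claim is that the quadratic form
     t |-> \sum_{s,p,q} conj(t_q) t_p N_{ps}^q x_s y_s / d_s
   is positive.  For every object X the ring acts on the direct sum over p of
   Hom(S_p, X (x) S_p) by sandwiching T (x) 1_j between the vertices
   S_q -> S_p (x) S_j, and Frobenius reciprocity makes this a
   star-representation, so x = a a^* gives a nonnegative form there.  Evaluated
   at X = S_r^* (x) S_r on the vectors t_p conj(b_k) d_k^{-1} d_r^{1/2} times the
   projection of S_r (x) S_p onto its S_k-isotypic part, and summed over r, this
   form is the one above: a sum over r of products of vertices is rotated into
   a trace, in which only the channel s survives, with weight 1 / d_s.

   The associators are avoided by replacing objects with the endofunctors
   Z |-> S_p (x) (S_j (x) ... Z), which compose strictly. *)
From HB Require Import structures.
From mathcomp Require Import all_boot all_order all_algebra.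
From mathcomp Require Import boolp classical_sets reals complex ring.
Require Import Defs.
Set Implicit Arguments.
Unset Strict Implicit.
Unset Printing Implicit Defensive.
Import Order.TTheory GRing.Theory Num.Theory.
Local Open Scope ring_scope.

(** No spherical structure is given, and a left dual comes without any relation to the dagger. Each
    duality is therefore rescaled until [ev] and [co] have the same norm d, and what a spherical
    trace would provide has to be proved: bending a strand multiplies inner products of vertices S_q
    -> S_p (x) S_j by d_q / d_p. Frobenius reciprocity for N, the multiplicativity of d and the
    adjoint of the action all come from this.

    Recoupling is done without 6j symbols: each time only the trace of a sesquilinear form over an
    orthonormal basis is needed, and that trace does not depend on the basis.

    The dimension in the theorem is an operator norm, with no duality in its definition. It agrees
    with d because d is a positive character of the ring, hence a common eigenvector of each left
    multiplication and its transpose.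

    The quadratic form is that of right multiplication by the convolution w on L^2(B). Its
    positivity yields w = z^* z because the positive square root of this operator commutes with all
    left multiplications, and is therefore again a right multiplication. *)

Section LinearCategory.
Variables (R : realType) (C : linearCategory R).
Implicit Types a b c : C.

(** * Bilinear composition, bricks and their scalars *)

Lemma compDl a b c (g g' : hom b c) (f : hom a b) :
  (g + g') \oc f = (g \oc f) + (g' \oc f).
Proof. by have := mcomp_linear_l f 1 g g'; rewrite !scale1r. Qed.

Lemma compDr a b c (g : hom b c) (f f' : hom a b) :
  g \oc (f + f') = (g \oc f) + (g \oc f').
Proof. by have := mcomp_linear_r g 1 f f'; rewrite !scale1r. Qed.

Lemma comp0m a b c (f : hom a b) : (0 : hom b c) \oc f = 0.
Proof. by apply: (@addrI _ (0 \oc f)); rewrite -compDl !addr0. Qed.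

Lemma compm0 a b c (g : hom b c) : g \oc (0 : hom a b) = 0.
Proof. by apply: (@addrI _ (g \oc 0)); rewrite -compDr !addr0. Qed.

Lemma compZl a b c k (g : hom b c) (f : hom a b) :
  (k *: g) \oc f = k *: (g \oc f).
Proof. by have := mcomp_linear_l f k g 0; rewrite !addr0 comp0m addr0. Qed.

Lemma compZr a b c k (g : hom b c) (f : hom a b) :
  g \oc (k *: f) = k *: (g \oc f).
Proof. by have := mcomp_linear_r g k f 0; rewrite !addr0 compm0 addr0. Qed.

Lemma compBl a b c (g g' : hom b c) (f : hom a b) :
  (g - g') \oc f = (g \oc f) - (g' \oc f).
Proof. by rewrite compDl -scaleN1r compZl scaleN1r. Qed.

Lemma compBr a b c (g : hom b c) (f f' : hom a b) :
  g \oc (f - f') = (g \oc f) - (g \oc f').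
Proof. by rewrite compDr -scaleN1r compZr scaleN1r. Qed.

Lemma comp_suml a b c I (r : seq I) (P : pred I) (G : I -> hom b c)
    (f : hom a b) :
  (\sum_(i <- r | P i) G i) \oc f = \sum_(i <- r | P i) (G i \oc f).
Proof.
apply: (big_morph (fun g => g \oc f)); first by move=> g g'; rewrite compDl.
exact: comp0m.
Qed.

Lemma comp_sumr a b c I (r : seq I) (P : pred I) (g : hom b c)
    (F : I -> hom a b) :
  g \oc (\sum_(i <- r | P i) F i) = \sum_(i <- r | P i) (g \oc F i).
Proof.
apply: (big_morph (fun f => g \oc f)); first by move=> f f'; rewrite compDr.
exact: compm0.
Qed.

Lemma iso_monic a b (f : hom a b) : is_iso f -> monic f.
Proof.
move=> [f' [f'f _]] c g h e.
by rewrite -[g]mcomp1m -[h]mcomp1m -f'f -!mcompA e.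
Qed.

Lemma iso_epic a b (f : hom a b) : is_iso f -> epic f.
Proof.
move=> [f' [_ ff']] c g h e.
by rewrite -[g]mcompm1 -[h]mcompm1 -ff' !mcompA e.
Qed.

(** The conclusion of Schur's lemma, kept as a notion of its own because it passes along
    isomorphisms, as from [S j] to [S j] tensored with the unit. *)
Definition brick a :=
  idm a != 0 /\ forall f : hom a a, exists k, f = k *: idm a.

(** Reading the scalar as a coordinate makes it linear on every [hom a a]; it recovers the map when
    [a] is a brick ([scalE]). *)
Definition scal a : hom a a -> (R[i])%C := coord [tuple idm a] ord0.

HB.instance Definition _ a := GRing.Linear.on (@scal a).

Lemma scal_sum a I (r : seq I) (P : pred I) (F : I -> hom a a) :
  scal (\sum_(i <- r | P i) F i) = \sum_(i <- r | P i) scal (F i).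
Proof. exact: linear_sum. Qed.

Lemma scalZ a k (f : hom a a) : scal (k *: f) = k * scal f.
Proof. exact: linearZ. Qed.

Lemma scal_id a : idm a != 0 -> scal (idm a) = 1.
Proof.
move=> h; rewrite /scal.
have fr : free [tuple idm a] by rewrite seq1_free.
by have := coord_free ord0 ord0 fr; rewrite eqxx.
Qed.

Lemma scalE a (f : hom a a) : brick a -> f = scal f *: idm a.
Proof. by case=> h0 /(_ f) [k ->]; rewrite linearZ /= scal_id // mulr1. Qed.

Lemma scale_id_inj a k l : brick a -> k *: idm a = l *: idm a -> k = l.
Proof.
by case=> n0 _ /(congr1 (@scal a)); rewrite !scalZ scal_id // !mulr1.
Qed.

Lemma brick_iso a b (f : hom a b) : is_iso f -> brick a -> brick b.
Proof.
move=> [g [gf fg]] [n0 h]; split.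
  apply: contraNneq n0 => e.
  by rewrite -gf -[f]mcomp1m e comp0m compm0.
move=> x; have [k e] := h (g \oc x \oc f); exists k.
have -> : x = f \oc (g \oc x \oc f) \oc g.
  by rewrite !mcompA fg mcomp1m -mcompA fg mcompm1.
by rewrite e compZr mcompm1 compZl fg.
Qed.

Lemma hom_iso_dim a a' b b' (f : hom a' a) (g : hom b b') :
  is_iso f -> is_iso g -> (\dim {: hom a b} <= \dim {: hom a' b'})%N.
Proof.
move=> fi gi.
pose T := fun x : hom a b => g \oc x \oc f.
have lT : linear T.
  by move=> k x y; rewrite /T compDr compDl compZr compZl.
pose TL := GRing.isLinear.Build _ _ _ _ T lT.
pose T' : {linear hom a b -> hom a' b'} := HB.pack T TL.
have kT : lker (linfun T') == 0%VS.
  apply/lker0P => x y; rewrite !lfunE /= /T => /(iso_epic fi) e.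
  exact: (iso_monic gi e).
by rewrite -(limg_dim_eq (f:=linfun T')) ?dimvS ?subvf // (eqP kT) capv0.
Qed.

End LinearCategory.

(** * Schur's lemma *)

Section SchurLemma.
Import VectorInternalTheory.
Variables (R : realType) (C : linearCategory R).
Hypothesis abC : abelian_category C.

Lemma simple_hom_iso (a b : C) (f : hom a b) :
  simple_object a -> simple_object b -> f != 0 -> is_iso f.
Proof.
case=> _ ha [_ hb] f0.
have [_ /(_ _ _ f) [c [k [fk ku]]] _ _ _] := abC.
have km : monic k.
  move=> d g h e; have := ku d (k \oc g); rewrite mcompA fk comp0m.
  by case=> // u [_ uu]; rewrite -(uu g erefl) (uu h).
case: (ha _ k km) => [k0|/iso_epic ki]; last first.
  by case/eqP: f0; apply: ki; rewrite comp0m.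
have fm : monic f.
  move=> d g h e; have := ku d (g - h).
  rewrite compBr e subrr => /(_ erefl) [u [+ _]].
  by rewrite k0 comp0m => /esym/eqP; rewrite subr_eq0 => /eqP.
by case: (hb _ f fm) => // e; rewrite e eqxx in f0.
Qed.

(** Over an algebraically closed field, left composition with f on the nonzero space End(a) has an
    eigenvalue k. Then f - k kills a nonzero map, so it is not invertible and must be 0. *)
Lemma simple_brick (a : C) : simple_object a -> brick a.
Proof.
move=> sa; split; first by case: sa.
move=> f.
pose T := fun x : hom a a => f \oc x.
have lT : linear T by move=> k x y; rewrite /T compDr compZr.
pose TL := GRing.isLinear.Build _ _ _ _ T lT.
pose T' : {linear hom a a -> hom a a} := HB.pack T TL.
pose A := lin1_mx (v2r \o T' \o r2v).
have dpos : (0 < dim (hom a a))%N.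
  rewrite lt0n; apply/eqP => d0; have [/eqP n0 _] := sa; apply: n0.
  apply: (can_inj v2rK); apply/rowP => i.
  by exfalso; move: i; rewrite d0 => -[].
have [k] := eigenvalue_closed A dpos.
case/eigenvalueP => v vA v0; exists k.
have [|nz] := eqVneq (f - k *: idm a) 0; first by move/eqP; rewrite subr_eq0 => /eqP.
have /iso_monic h := simple_hom_iso sa sa nz.
case/eqP: v0; apply: (can_inj r2vK); rewrite linear0.
apply: h; rewrite compm0 compBl compZl mcomp1m.
apply/eqP; rewrite subr_eq0; apply/eqP.
move: vA; rewrite mul_rV_lin1 /= => /(congr1 r2v).
by rewrite v2rK linearZ.
Qed.

End SchurLemma.

(** * The dagger and the inner product on maps out of a brick *)

Section Dagger.
Variables (R : realType) (C : linearCategory R) (D : starStructure C).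
Implicit Types a b c : C.
Local Notation dg := (dag D).

Lemma dagD a b (f g : hom a b) : dg (f + g) = dg f + dg g.
Proof. by have := dag_antilinear D 1 f g; rewrite scale1r rmorph1 scale1r. Qed.

Lemma dag0 a b : dg (0 : hom a b) = 0.
Proof. by apply: (@addrI _ (dg 0)); rewrite -dagD !addr0. Qed.

Lemma dagZ a b k (f : hom a b) : dg (k *: f) = k^* *: dg f.
Proof. by have := dag_antilinear D k f 0; rewrite !addr0 dag0 addr0. Qed.

Lemma dagB a b (f g : hom a b) : dg (f - g) = dg f - dg g.
Proof. by rewrite dagD -scaleN1r dagZ rmorphN rmorph1 scaleN1r. Qed.

Lemma dag_sum a b I (r : seq I) (P : pred I) (F : I -> hom a b) :
  dg (\sum_(i <- r | P i) F i) = \sum_(i <- r | P i) dg (F i).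
Proof.
by apply: (big_morph (@dag _ _ D a b));
  [move=> f g; rewrite dagD|rewrite dag0].
Qed.

Lemma dag_id a : dg (idm a) = idm a.
Proof. by rewrite -[dg _]mcompm1 -[X in _ \oc X](dagK D) -dag_comp mcompm1 dagK. Qed.

Lemma scal_dag a (f : hom a a) : brick a -> scal (dg f) = (scal f)^*.
Proof.
move=> ba; rewrite [in LHS](scalE f ba) dagZ dag_id linearZ /= scal_id ?mulr1 //.
by case: ba.
Qed.

(** [dag_pos] trades [f] for an endomorphism of the brick, so the value is the squared modulus of a
    scalar. *)
Lemma scal_dag_ge0 a b (f : hom a b) : brick a -> 0 <= scal (dg f \oc f).
Proof.
move=> ba; have [g ->] := dag_pos D f.
rewrite {2}(scalE g ba) compZr mcompm1 linearZ /= scal_dag // mul_conjC_ge0 //.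
Qed.

Lemma dag_comp_eq0 a b (f : hom a b) : dg f \oc f = 0 -> f = 0.
Proof.
move=> h; apply: (cnorm_eq0 (s := D)); apply/eqP.
have : cnorm D f ^+ 2 == 0.
  rewrite -cnorm_cstar h.
  have := cnormZ D 0 (0 : hom a a).
  by rewrite scale0r normr0 mul0r => -[->].
by rewrite expf_eq0.
Qed.

Lemma scal_dag_eq0 a b (f : hom a b) :
  brick a -> scal (dg f \oc f) = 0 -> f = 0.
Proof.
by move=> ba h; apply: dag_comp_eq0; rewrite (scalE (_ \oc _) ba) h scale0r.
Qed.

End Dagger.

(** * A strict model of the tensor product *)

Section MonoidalCategory.
Variables (R : realType) (C : unitaryFusionCategory R).
Let M := ufc_tens C.
Let D := ufc_star C.
Implicit Types a b c Z Y A : C.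
Local Notation dg := (dag D).
Local Notation U := (tunit M).
Local Notation "a \ox b" := (tens M a b) (at level 40, left associativity).
Local Notation "f \tm g" := (tensm M f g) (at level 40, left associativity).
Local Notation "a |> f" := (tensm M (idm a) f)
  (at level 45, right associativity).
Local Notation assoc := (associator M).

Lemma tm_comp_l a a' a'' Y (f : hom a a') (g : hom a' a'') :
  (g \oc f) \tm idm Y = (g \tm idm Y) \oc (f \tm idm Y).
Proof. by rewrite -tensm_comp mcomp1m. Qed.

Lemma lw_comp a Z Y A (g : hom Y A) (f : hom Z Y) :
  a |> (g \oc f) = (a |> g) \oc (a |> f).
Proof. by rewrite -tensm_comp mcomp1m. Qed.

Lemma lw_id a Z : a |> idm Z = idm (a \ox Z).
Proof. exact: tensm1. Qed.

Lemma lwD a Z Y (f g : hom Z Y) : a |> (f + g) = (a |> f) + (a |> g).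
Proof. by have := tensm_linear_r M (idm a) 1 f g; rewrite !scale1r. Qed.

Lemma lw0 a Z Y : a |> (0 : hom Z Y) = 0.
Proof. by apply: (@addrI _ (a |> 0)); rewrite -lwD !addr0. Qed.

Lemma lwZ a Z Y k (f : hom Z Y) : a |> (k *: f) = k *: (a |> f).
Proof. by have := tensm_linear_r M (idm a) k f 0; rewrite !addr0 lw0 addr0. Qed.

Lemma lw_sum a Z Y I (r : seq I) (P : pred I) (F : I -> hom Z Y) :
  a |> (\sum_(i <- r | P i) F i) = \sum_(i <- r | P i) (a |> F i).
Proof.
apply: (big_morph (fun f => a |> f)); first by move=> f f'; rewrite lwD.
exact: lw0.
Qed.

Lemma lw_dag a Z Y (f : hom Z Y) : dg (a |> f) = a |> dg f.
Proof. by rewrite ufc_dag_tens dag_id. Qed.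

Lemma tmDl a b Y (f g : hom a b) :
  (f + g) \tm idm Y = (f \tm idm Y) + (g \tm idm Y).
Proof. by have := tensm_linear_l M (idm Y) 1 f g; rewrite !scale1r. Qed.

Lemma tm0l a b Y : (0 : hom a b) \tm idm Y = 0.
Proof. by apply: (@addrI _ (0 \tm idm Y)); rewrite -tmDl !addr0. Qed.

Lemma tmZl a b Y k (f : hom a b) : (k *: f) \tm idm Y = k *: (f \tm idm Y).
Proof. by have := tensm_linear_l M (idm Y) k f 0; rewrite !addr0 tm0l addr0. Qed.

Lemma tm_suml a b Y I (r : seq I) (P : pred I) (F : I -> hom a b) :
  (\sum_(i <- r | P i) F i) \tm idm Y = \sum_(i <- r | P i) (F i \tm idm Y).
Proof.
apply: (big_morph (fun f => f \tm idm Y)); first by move=> f f'; rewrite tmDl.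
exact: tm0l.
Qed.

Lemma tm_dagl a b Y (f : hom a b) : dg (f \tm idm Y) = dg f \tm idm Y.
Proof. by rewrite ufc_dag_tens dag_id. Qed.

Lemma tm_iso a b a' b' (f : hom a a') (g : hom b b') :
  is_iso f -> is_iso g -> is_iso (f \tm g).
Proof.
move=> [f' [f1 f2]] [g' [g1 g2]]; exists (f' \tm g').
by rewrite -!tensm_comp f1 f2 g1 g2 !tensm1.
Qed.

Lemma id_iso a : is_iso (idm a).
Proof. by exists (idm a); rewrite mcomp1m. Qed.

Lemma comp_iso a b c (g : hom b c) (f : hom a b) :
  is_iso g -> is_iso f -> is_iso (g \oc f).
Proof.
move=> [g' [g1 g2]] [f' [f1 f2]]; exists (f' \oc g'); split.
  by rewrite mcompA -(mcompA f') g1 mcompm1.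
by rewrite mcompA -(mcompA g) f2 mcompm1.
Qed.

Lemma dag_assocK a b c : dg (assoc a b c) \oc assoc a b c = idm _.
Proof. by case: (ufc_assoc a b c). Qed.

Lemma assoc_dagK a b c : assoc a b c \oc dg (assoc a b c) = idm _.
Proof. by case: (ufc_assoc a b c). Qed.

Lemma lunit_dagK a : lunit M a \oc dg (lunit M a) = idm _.
Proof. by case: (ufc_lunit a). Qed.

Lemma lunit_inj a b (f g : hom a b) : U |> f = U |> g -> f = g.
Proof.
move=> e; apply: (iso_epic (lunit_iso M a)).
by rewrite -!lunit_nat e.
Qed.

(* Kelly's coherence: tensor with the unit on the left, then compare the
   pentagon for (1, 1, Z, Y) with two triangles. *)
Lemma lunit_tens Z Y :
  lunit M (Z \ox Y) \oc assoc U Z Y = lunit M Z \tm idm Y.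
Proof.
apply: lunit_inj.
have i1 : is_iso (assoc U (U \ox Z) Y \oc (assoc U U Z \tm idm Y)).
  apply: comp_iso; first exact: assoc_iso.
  by apply: tm_iso; [exact: assoc_iso|exact: id_iso].
apply: (iso_epic i1).
rewrite lw_comp -[LHS]mcompA [(U |> assoc U Z Y) \oc _]mcompA.
rewrite -pentagon mcompA triangle -[idm (Z \ox Y)]tensm1 -assoc_nat.
rewrite [RHS]mcompA -[U |> (lunit M Z \tm idm Y)]/(idm U \tm _).
by rewrite -assoc_nat -[RHS]mcompA -tm_comp_l triangle.
Qed.

(* Endofunctors with a right module structure, and their right module
   natural transformations, form a strict model of the monoidal category:
   [erho] is the module constraint, composed with an arbitrary morphism so
   that [compE] is associative and unital by conversion. *)
Record endo := Endo {
  eob :> C -> C;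
  emap : forall Z Y, hom Z Y -> hom (eob Z) (eob Y);
  erho : forall Z Y A, hom (Z \ox Y) A -> hom (eob Z \ox Y) (eob A) }.

Definition idE : endo :=
  @Endo (fun Z => Z) (fun Z Y g => g) (fun Z Y A g => g).

Definition lE a : endo :=
  @Endo (fun Z => a \ox Z) (fun Z Y g => a |> g)
    (fun Z Y A g => (a |> g) \oc assoc a Z Y).

Definition compE (E F : endo) : endo :=
  @Endo (fun Z => E (F Z)) (fun Z Y g => emap E (emap F g))
    (fun Z Y A g => erho E (erho F g)).

Definition W : seq C -> endo := foldr (fun a E => compE (lE a) E) idE.

Implicit Types E F G H : endo.

(** The laws stay outside [endo], whose composites then consist of data alone and can agree by
    conversion. *)
Record lawful (E : endo) : Prop := Lawful {
  emap_dag : forall Z Y (g : hom Z Y), dg (emap E g) = emap E (dg g);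
  emap_comp : forall Z Y A (g : hom Y A) (f : hom Z Y),
    emap E (g \oc f) = emap E g \oc emap E f;
  emap_id : forall Z, emap E (idm Z) = idm (E Z);
  erhoE : forall Z Y A B (h : hom A B) (g : hom (Z \ox Y) A),
    erho E (h \oc g) = emap E h \oc erho E g;
  erho_unitary : forall Z Y, unitary D (erho E (idm (Z \ox Y))) }.

Lemma unitary_comp a b c (g : hom b c) (f : hom a b) :
  unitary D g -> unitary D f -> unitary D (g \oc f).
Proof.
move=> [g1 g2] [f1 f2]; rewrite /unitary dag_comp; split.
  by rewrite mcompA -(mcompA (dg f)) g1 mcompm1.
by rewrite mcompA -(mcompA g) f2 mcompm1.
Qed.

Lemma unitary_iso a b (f : hom a b) : unitary D f -> is_iso f.
Proof. by case=> f1 f2; exists (dg f). Qed.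

Lemma lawful_W w : lawful (W w).
Proof.
elim: w => [|a w [hd hc hi hr hu]] /=.
  by split=> //= *; rewrite ?/unitary ?dag_id ?mcomp1m.
split=> /=.
- by move=> *; rewrite lw_dag hd.
- by move=> *; rewrite hc lw_comp.
- by move=> *; rewrite hi lw_id.
- by move=> Z Y A B h g; rewrite hr lw_comp mcompA.
- move=> Z Y; apply: unitary_comp; last exact: ufc_assoc.
  have [h1 h2] := hu Z Y.
  by rewrite /unitary lw_dag -!lw_comp h1 h2 !lw_id.
Qed.

Record mor E F (f : forall Z, hom (E Z) (F Z)) : Prop := Mor {
  mor_nat : forall Z Y (g : hom Z Y), f Y \oc emap E g = emap F g \oc f Z;
  mor_mod : forall Z Y A (g : hom (Z \ox Y) A),
    erho F g \oc (f Z \tm idm Y) = f A \oc erho E g }.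

Lemma mor_id E : mor (E := E) (F := E) (fun Z => idm (E Z)).
Proof. by split=> *; rewrite ?tensm1 ?mcomp1m ?mcompm1. Qed.

Lemma mor_comp E F G (g : forall Z, hom (F Z) (G Z))
    (f : forall Z, hom (E Z) (F Z)) :
  mor g -> mor f -> mor (fun Z => g Z \oc f Z).
Proof.
move=> [g1 g2] [f1 f2]; split=> *.
  by rewrite -mcompA f1 !mcompA g1.
by rewrite tm_comp_l mcompA g2 -!mcompA f2.
Qed.

Lemma mor_lw a E F (f : forall Z, hom (E Z) (F Z)) :
  mor f -> mor (E := compE (lE a) E) (F := compE (lE a) F)
               (fun Z => a |> f Z).
Proof.
move=> [f1 f2]; split=> [Z Y g|Z Y A g] /=.
  by rewrite -!lw_comp f1.
rewrite -mcompA -[a |> f Z]/(idm a \tm f Z) assoc_nat.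
by rewrite [LHS]mcompA -lw_comp f2 lw_comp mcompA.
Qed.

Lemma mor_rw H E F (f : forall Z, hom (E Z) (F Z)) :
  mor f -> mor (E := compE E H) (F := compE F H) (fun Z => f (H Z)).
Proof. by move=> [f1 f2]; split=> [Z Y g|Z Y A g] /=; rewrite ?f1 ?f2. Qed.

Lemma mor_dag E F (f : forall Z, hom (E Z) (F Z)) :
  lawful E -> lawful F -> mor f -> mor (fun Z => dg (f Z)).
Proof.
move=> lE lF [f1 f2]; split=> [Z Y g|Z Y A g].
  by have := congr1 dg (f1 _ _ (dg g)); rewrite !dag_comp !emap_dag // dagK => ->.
have [r1 r2] := erho_unitary lE Z Y.
have [s1 s2] := erho_unitary lF Z Y.
rewrite -[g]mcompm1 !erhoE // mcompA.
have nd : dg (f A) \oc emap F g = emap E g \oc dg (f _).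
  by have := congr1 dg (f1 _ _ (dg g)); rewrite !dag_comp !emap_dag // dagK => ->.
rewrite nd -!mcompA; congr (_ \oc _).
have := congr1 dg (f2 _ _ _ (idm (Z \ox Y))).
rewrite !dag_comp tm_dagl => e.
rewrite -[dg (f Z) \tm _]mcompm1 -s1 [_ \oc (dg (erho _ _) \oc _)]mcompA e.
by rewrite !mcompA r2 mcomp1m.
Qed.

Lemma mor_sum E F I (r : seq I) (P : pred I)
    (f : I -> forall Z, hom (E Z) (F Z)) :
  (forall i, mor (f i)) -> mor (fun Z => \sum_(i <- r | P i) f i Z).
Proof.
move=> h; split=> *.
  rewrite comp_suml comp_sumr; apply: eq_bigr => i _.
  exact: mor_nat.
rewrite tm_suml comp_suml comp_sumr; apply: eq_bigr => i _.
exact: mor_mod.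
Qed.

Lemma mor_scale E F k (f : forall Z, hom (E Z) (F Z)) :
  mor f -> mor (fun Z => k *: f Z).
Proof.
move=> [f1 f2]; split=> *; first by rewrite compZl compZr f1.
by rewrite tmZl compZl compZr f2.
Qed.

(** The left unitor presents Z as the unit tensored with Z, and the module constraint carries the
    component at the unit there. Identities of transformations thus reduce to one hom space, where a
    brick leaves only a scalar ([mor_scal]). *)
Lemma mor_unit_inj E F (f g : forall Z, hom (E Z) (F Z)) :
  lawful E -> mor f -> mor g -> f U = g U -> forall Z, f Z = g Z.
Proof.
move=> hE [_ f2] [_ g2] e Z.
suff h : is_iso (erho E (lunit M Z)).
  by apply: (iso_epic h); rewrite -f2 -g2 e.
rewrite -[lunit M Z]mcompm1 erhoE //; apply: comp_iso.
  have [l [l1 l2]] := lunit_iso M Z.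
  by exists (emap E l); rewrite -!emap_comp // l1 l2 !emap_id.
exact/unitary_iso/erho_unitary.
Qed.

Lemma mor_scal E (f : forall Z, hom (E Z) (E Z)) :
  lawful E -> brick (E U) -> mor f ->
  forall Z, f Z = scal (f U) *: idm (E Z).
Proof.
move=> hE bE hf.
apply: mor_unit_inj => //; last exact: scalE.
exact/mor_scale/mor_id.
Qed.

Lemma mor_tm2 a b c (f : hom a (b \ox c)) :
  mor (E := W [:: a]) (F := W [:: b; c])
      (fun Z => assoc b c Z \oc (f \tm idm Z)).
Proof.
split=> [Z Y g|Z Y A g] /=.
  rewrite -mcompA -tensm_comp mcomp1m mcompm1.
  rewrite [RHS]mcompA -[b |> c |> g]/(idm b \tm (idm c \tm g)) -assoc_nat.
  by rewrite tensm1 -mcompA -tensm_comp mcomp1m mcompm1.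
rewrite tm_comp_l lw_comp -!mcompA.
rewrite [assoc b _ _ \oc _]mcompA [(b |> assoc c Z Y) \oc _]mcompA.
rewrite [(b |> assoc c Z Y) \oc _]mcompA -pentagon.
rewrite -[(assoc b c (Z \ox Y) \oc _) \oc _]mcompA assoc_nat tensm1.
rewrite [assoc b c _ \oc _]mcompA [LHS]mcompA [(b |> c |> g) \oc _]mcompA.
rewrite -[b |> c |> g]/(idm b \tm (idm c \tm g)) -assoc_nat tensm1.
rewrite -[_ \oc (f \tm _)]mcompA -tensm_comp mcomp1m mcompm1.
rewrite [(f \tm idm A) \oc _]mcompA -tensm_comp mcomp1m mcompm1.
by rewrite !mcompA.
Qed.

Lemma mor_ev a b (f : hom (b \ox a) U) :
  mor (E := W [:: b; a]) (F := W [::])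
      (fun Z => lunit M Z \oc (f \tm idm Z) \oc dg (assoc b a Z)).
Proof.
have n1 Z Y (g : hom Z Y) :
    dg (assoc b a Y) \oc (b |> a |> g) = (idm _ \tm g) \oc dg (assoc b a Z).
  have e := assoc_nat M (idm b) (idm a) g.
  rewrite -[LHS]mcompm1 -(assoc_dagK b a Z) -!mcompA.
  rewrite [_ \oc (assoc _ _ _ \oc _)]mcompA -e -!mcompA.
  by rewrite [LHS]mcompA dag_assocK mcomp1m tensm1.
(* The pentagon for b, a, Z, Y with two of its associators moved across. *)
have m1 Z Y : dg (assoc b a (Z \ox Y)) \oc (b |> assoc a Z Y)
    \oc assoc b (a \ox Z) Y = assoc (b \ox a) Z Y \oc (dg (assoc b a Z) \tm idm Y).
  have i1 : is_iso (assoc b a Z \tm idm Y).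
    by apply: tm_iso; [exact: assoc_iso|exact: id_iso].
  apply: (iso_epic i1).
  rewrite -[RHS]mcompA -tm_comp_l dag_assocK tensm1 mcompm1.
  rewrite -!mcompA [(b |> _) \oc (_ \oc _)]mcompA -pentagon.
  by rewrite mcompA dag_assocK mcomp1m.
have n2 Z Y (g : hom Z Y) :
    (f \tm idm Y) \oc (idm _ \tm g) = (U |> g) \oc (f \tm idm Z).
  by rewrite -!tensm_comp !mcomp1m !mcompm1.
split=> [Z Y g|Z Y A g] /=.
  rewrite -!mcompA n1 [(f \tm _) \oc _]mcompA n2 !mcompA.
  by rewrite lunit_nat.
rewrite lw_comp -[RHS]mcompA.
have -> : dg (assoc b a A) \oc ((b |> (a |> g)) \oc (b |> assoc a Z Y)
      \oc assoc b (a \ox Z) Y) =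
   (idm _ \tm g) \oc assoc (b \ox a) Z Y \oc (dg (assoc b a Z) \tm idm Y).
  by rewrite -!mcompA -m1 !mcompA n1.
rewrite !mcompA -[_ \oc (f \tm idm A) \oc _]mcompA n2 !mcompA lunit_nat.
rewrite !tm_comp_l -lunit_tens -!mcompA; congr (_ \oc _); congr (_ \oc _).
by rewrite !mcompA assoc_nat tensm1.
Qed.

End MonoidalCategory.

(** * Duality with balanced norms *)

Section DualPairs.
Variables (R : realType) (C : unitaryFusionCategory R).
Let M := ufc_tens C.
Let D := ufc_star C.
Implicit Types a b c Z Y A : C.
Local Notation dg := (dag D).
Local Notation U := (tunit M).
Local Notation "a \ox b" := (tens M a b) (at level 40, left associativity).
Local Notation "f \tm g" := (tensm M f g) (at level 40, left associativity).
Local Notation "a |> f" := (tensm M (idm a) f)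
  (at level 45, right associativity).
Local Notation assoc := (associator M).

Lemma comp_eqA a b b' c Z (g : hom b c) (f : hom a b) (g' : hom b' c)
    (f' : hom a b') :
  g \oc f = g' \oc f' -> forall k : hom Z a, g \oc (f \oc k) = g' \oc (f' \oc k).
Proof. by move=> e k; rewrite !mcompA e. Qed.

Lemma comp_eqA1 a b c Z (g : hom b c) (f : hom a b) (h : hom a c) :
  g \oc f = h -> forall k : hom Z a, g \oc (f \oc k) = h \oc k.
Proof. by move=> e k; rewrite mcompA e. Qed.

(** Scaling [ev] by r and [co] by 1/r preserves the snake identities and the product of the two
    norms; asking for equal norms is what fixes d. *)
Record dual_pair a b (ev : forall Z, hom (b \ox (a \ox Z)) Z)
    (co : forall Z, hom Z (a \ox (b \ox Z))) (d : (R[i])%C) : Prop := DualPair {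
  ev_mor : mor (E := W [:: b; a]) (F := W [::]) ev;
  co_mor : mor (E := W [::]) (F := W [:: a; b]) co;
  snake_l : forall Z, (a |> ev Z) \oc co (a \ox Z) = idm (a \ox Z);
  snake_r : forall Z, ev (b \ox Z) \oc (b |> co Z) = idm (b \ox Z);
  ev_norm : forall Z, ev Z \oc dg (ev Z) = d *: idm Z;
  co_norm : forall Z, dg (co Z) \oc co Z = d *: idm Z;
  dual_pair_gt0 : 0 < d }.

Lemma dual_pair_sym a b ev co d : @dual_pair a b ev co d ->
  @dual_pair b a (fun Z => dg (co Z)) (fun Z => dg (ev Z)) d.
Proof.
case=> e1 c1 sl sr en cn d0; split=> //.
- exact: (mor_dag (lawful_W [::]) (lawful_W [:: a; b]) c1).
- exact: (mor_dag (lawful_W [:: b; a]) (lawful_W [::]) e1).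
- by move=> Z; have := congr1 dg (sr Z); rewrite dag_comp lw_dag dag_id.
- by move=> Z; have := congr1 dg (sl Z); rewrite dag_comp lw_dag dag_id.
- by move=> Z; rewrite dagK cn.
- by move=> Z; rewrite dagK en.
Qed.

(** The coevaluation is built as the dagger of an evaluation, so [mor_ev] serves for both. Pentagon
    and triangle reduce each snake to the one for objects, tensored with Z. *)
Lemma left_dual_families a b : is_left_dual M a b ->
  exists (ev : forall Z, hom (b \ox (a \ox Z)) Z)
         (co : forall Z, hom Z (a \ox (b \ox Z))),
  [/\ mor (E := W [:: b; a]) (F := W [::]) ev,
      mor (E := W [::]) (F := W [:: a; b]) co,
      forall Z, (a |> ev Z) \oc co (a \ox Z) = idm (a \ox Z)
    & forall Z, ev (b \ox Z) \oc (b |> co Z) = idm (b \ox Z)].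
Proof.
case=> ev [co [ai [ai1 _ s1 s2]]].
have {ai1} aiE : ai = dg (assoc b a b).
  apply: (iso_epic (assoc_iso M b a b)).
  by rewrite ai1 dag_assocK.
subst ai.
exists (fun Z => lunit M Z \oc (ev \tm idm Z) \oc dg (assoc b a Z)).
exists (fun Z => dg (lunit M Z \oc (dg co \tm idm Z) \oc dg (assoc a b Z))).
split.
- exact: mor_ev.
- exact: (mor_dag (lawful_W [:: a; b]) (lawful_W [::]) (mor_ev (dg co))).
- move=> Z; rewrite !dag_comp dagK tm_dagl dagK !lw_comp -!mcompA.
  have pent : (a |> dg (assoc b a Z)) \oc assoc a b (a \ox Z)
      = assoc a (b \ox a) Z
          \oc ((assoc a b a \tm idm Z) \oc dg (assoc (a \ox b) a Z)).
    rewrite -[LHS]mcompm1 -(assoc_dagK (a \ox b) a Z) -mcompA.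
    rewrite [assoc a b _ \oc _]mcompA pentagon -!mcompA.
    by rewrite [LHS]mcompA -lw_comp dag_assocK lw_id mcomp1m.
  have nco : dg (assoc (a \ox b) a Z) \oc (co \tm idm (a \ox Z))
      = ((co \tm idm a) \tm idm Z) \oc dg (assoc U a Z).
    have e := assoc_nat M co (idm a) (idm Z).
    rewrite tensm1 in e.
    rewrite -[LHS]mcompm1 -(assoc_dagK U a Z) -!mcompA.
    rewrite [(co \tm _) \oc _]mcompA -e -mcompA [LHS]mcompA.
    by rewrite dag_assocK mcomp1m.
  rewrite (comp_eqA pent) -!mcompA (comp_eqA nco).
  have nev : (a |> (ev \tm idm Z)) \oc assoc a (b \ox a) Z
      = assoc a U Z \oc ((a |> ev) \tm idm Z) by rewrite assoc_nat.
  rewrite (comp_eqA nev) (comp_eqA1 (triangle M a Z)).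
  rewrite !mcompA -!tm_comp_l s1 -lunit_tens.
  by rewrite -[X in X \oc _]mcompA assoc_dagK mcompm1 lunit_dagK.
- move=> Z; rewrite !dag_comp dagK tm_dagl dagK !lw_comp -!mcompA.
  have pent : dg (assoc b a (b \ox Z)) \oc (b |> assoc a b Z)
      = assoc (b \ox a) b Z
          \oc ((dg (assoc b a b) \tm idm Z) \oc dg (assoc b (a \ox b) Z)).
    have i1 : is_iso (assoc b (a \ox b) Z \oc (assoc b a b \tm idm Z)).
      apply: comp_iso; first exact: assoc_iso.
      by apply: tm_iso; [exact: assoc_iso|exact: id_iso].
    apply: (iso_epic i1).
    rewrite -!mcompA (comp_eqA1 (dag_assocK b (a \ox b) Z)) mcomp1m -tm_comp_l.
    rewrite dag_assocK tensm1 mcompm1 [(b |> _) \oc _]mcompA -pentagon.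
    by rewrite mcompA dag_assocK mcomp1m.
  have nco : dg (assoc b (a \ox b) Z) \oc (b |> (co \tm idm Z))
      = ((b |> co) \tm idm Z) \oc dg (assoc b U Z).
    have e := assoc_nat M (idm b) co (idm Z).
    rewrite -[LHS]mcompm1 -(assoc_dagK b U Z) -!mcompA.
    rewrite [(b |> _) \oc _]mcompA -e -mcompA [LHS]mcompA.
    by rewrite dag_assocK mcomp1m.
  have nev : (ev \tm idm (b \ox Z)) \oc assoc (b \ox a) b Z
      = assoc U b Z \oc ((ev \tm idm b) \tm idm Z).
    by rewrite assoc_nat tensm1.
  rewrite (comp_eqA pent) -!mcompA (comp_eqA nco) (comp_eqA nev).
  rewrite (comp_eqA1 (lunit_tens b Z)) !mcompA -!tm_comp_l s2 -(triangle M b Z).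
  rewrite -[X in X \oc _]mcompA assoc_dagK mcompm1 -lw_comp lunit_dagK.
  exact: lw_id.
Qed.

Lemma left_dual_pair a b : brick U -> brick (a \ox U) -> is_left_dual M a b ->
  exists ev co d, @dual_pair a b ev co d.
Proof.
move=> bU ba /left_dual_families [ev [co [em cm sl sr]]].
have e0 Z : ev Z \oc dg (ev Z) = scal (ev U \oc dg (ev U)) *: idm Z.
  have md := mor_dag (lawful_W [:: b; a]) (lawful_W [::]) em.
  exact: (mor_scal (lawful_W [::]) bU (mor_comp em md)).
have c0 Z : dg (co Z) \oc co Z = scal (dg (co U) \oc co U) *: idm Z.
  have md := mor_dag (lawful_W [::]) (lawful_W [:: a; b]) cm.
  exact: (mor_scal (lawful_W [::]) bU (mor_comp md cm)).
set s := scal _ in e0; set t := scal _ in c0.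
(* If the norm were 0, [ev U] would vanish, and a snake identity would make the identity of a brick
   zero. *)
have s0 : 0 < s.
  rewrite lt0r; apply/andP; split; last first.
    by have := scal_dag_ge0 D (dg (ev U)) bU; rewrite dagK.
  apply/eqP => z; case: ba => /eqP n0 _; apply: n0.
  rewrite -sl -[ev U](dagK D).
  have -> : dg (ev U) = 0.
    by apply: (dag_comp_eq0 (D := D)); rewrite dagK e0 z scale0r.
  by rewrite dag0 lw0 comp0m.
have t0 : 0 < t.
  rewrite lt0r; apply/andP; split; last exact: scal_dag_ge0.
  apply/eqP => z; case: ba => /eqP n0 _; apply: n0.
  rewrite -sl; have -> : co (a \ox U) = 0.
    by apply: (dag_comp_eq0 (D := D)); rewrite c0 z scale0r.
  by rewrite compm0.
(* The norms become r^2 s and r^-2 t, which agree exactly when r^4 = t / s. *)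
pose r := sqrtC (sqrtC (t / s)).
have r0 : 0 < r by rewrite !sqrtC_gt0 divr_gt0.
have rr : r^* = r by apply/CrealP/ger0_real/ltW.
have rV : (r^-1)^* = r^-1 by apply/CrealP/ger0_real; rewrite invr_ge0 ltW.
have r4 : r ^+ 2 * r ^+ 2 * s = t.
  by rewrite -expr2 !sqrtCK divfK // gt_eqF.
have rn : r != 0 by rewrite gt_eqF.
exists (fun Z => r *: ev Z), (fun Z => r^-1 *: co Z), (r ^+ 2 * s); split.
- exact: (mor_scale (E := W [:: b; a]) (F := W [::])).
- exact: (mor_scale (E := W [::]) (F := W [:: a; b])).
- by move=> Z; rewrite lwZ compZl compZr scalerA divff // scale1r sl.
- by move=> Z; rewrite lwZ compZl compZr scalerA divff // scale1r sr.
- by move=> Z; rewrite dagZ compZl compZr rr e0 !scalerA -expr2.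
- move=> Z; rewrite dagZ compZl compZr rV c0 !scalerA -r4.
  by rewrite -invfM -expr2 -(mulrA (r ^+ 2)) mulKf ?expf_neq0.
- by rewrite mulr_gt0 // exprn_gt0.
Qed.

End DualPairs.

(** * Rotation of vertices and Frobenius reciprocity *)

Section FrobeniusReciprocity.
Variables (R : realType) (C : unitaryFusionCategory R).
Let M := ufc_tens C.
Let D := ufc_star C.
Implicit Types a b c Z Y A p q j : C.
Local Notation dg := (dag D).
Local Notation U := (tunit M).
Local Notation "a \ox b" := (tens M a b) (at level 40, left associativity).
Local Notation "a |> f" := (tensm M (idm a) f)
  (at level 45, right associativity).

(* The dagger of u with the strand j bent to the right (with [co]),
   respectively with the strand p bent to the left (with [ev]). *)
Definition rrot p q j j' (co : forall Z, hom Z (j \ox (j' \ox Z)))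
    (u : forall Z, hom (q \ox Z) (p \ox (j \ox Z))) Z :
    hom (p \ox Z) (q \ox (j' \ox Z)) :=
  dg (u (j' \ox Z)) \oc (p |> co Z).

Definition lrot p p' q j (ev : forall Z, hom (p' \ox (p \ox Z)) Z)
    (u : forall Z, hom (q \ox Z) (p \ox (j \ox Z))) Z :
    hom (j \ox Z) (p' \ox (q \ox Z)) :=
  (p' |> dg (u Z)) \oc dg (ev (j \ox Z)).

Lemma mor_rrot p q j j' co (u : forall Z, hom (q \ox Z) (p \ox (j \ox Z))) :
  mor (E := W [::]) (F := W [:: j; j']) co ->
  mor (E := W [:: q]) (F := W [:: p; j]) u ->
  mor (E := W [:: p]) (F := W [:: q; j']) (rrot co u).
Proof.
move=> hc hu; have hd := mor_dag (lawful_W [:: q]) (lawful_W [:: p; j]) hu.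
exact: (mor_comp (mor_rw (W [:: j']) hd) (mor_lw p hc)).
Qed.

Lemma mor_lrot p p' q j ev (u : forall Z, hom (q \ox Z) (p \ox (j \ox Z))) :
  mor (E := W [:: p'; p]) (F := W [::]) ev ->
  mor (E := W [:: q]) (F := W [:: p; j]) u ->
  mor (E := W [:: j]) (F := W [:: p'; q]) (lrot ev u).
Proof.
move=> he hu; have hd := mor_dag (lawful_W [:: q]) (lawful_W [:: p; j]) hu.
have hf := mor_dag (lawful_W [:: p'; p]) (lawful_W [::]) he.
exact: (mor_comp (mor_lw p' hd) (mor_rw (W [:: j]) hf)).
Qed.

Lemma rrotK p q j j' ev co d (u : forall Z, hom (q \ox Z) (p \ox (j \ox Z))) :
  @dual_pair _ C j j' ev co d ->
  mor (E := W [:: q]) (F := W [:: p; j]) u ->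
  forall Z, rrot (fun Z => dg (ev Z)) (rrot co u) Z = u Z.
Proof.
move=> hj /mor_nat nu Z; rewrite /rrot dag_comp dagK lw_dag -mcompA.
rewrite [u _ \oc _]nu /= mcompA -lw_comp.
have := congr1 dg (snake_l hj Z); rewrite dag_comp lw_dag dag_id => ->.
by rewrite lw_id mcomp1m.
Qed.

Section Comparison.
Variables (p p' q q' j j' : C).
Variables (ev_p : forall Z, hom (p' \ox (p \ox Z)) Z)
          (co_p : forall Z, hom Z (p \ox (p' \ox Z))) (d_p : (R[i])%C).
Variables (ev_q : forall Z, hom (q' \ox (q \ox Z)) Z)
          (co_q : forall Z, hom Z (q \ox (q' \ox Z))) (d_q : (R[i])%C).
Variables (ev_j : forall Z, hom (j' \ox (j \ox Z)) Z)
          (co_j : forall Z, hom Z (j \ox (j' \ox Z))) (d_j : (R[i])%C).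
Hypotheses (hp : dual_pair ev_p co_p d_p) (hq : dual_pair ev_q co_q d_q)
           (hj : dual_pair ev_j co_j d_j).
Hypotheses (bU : brick U) (bp : brick (p \ox U)) (bq : brick (q \ox U))
           (bj : brick (j \ox U)) (bq' : brick (q' \ox U)).
Implicit Types u v : forall Z, hom (q \ox Z) (p \ox (j \ox Z)).
Local Notation morph u := (mor (E := W [:: q]) (F := W [:: p; j]) u).

(* Both sides are the value of the same closed diagram, in which the strands
   p and j are closed in either order. *)
Lemma rrot_lrot u v s t : morph u -> morph v ->
  (forall Z, dg (rrot co_j v Z) \oc rrot co_j u Z = s *: idm (p \ox Z)) ->
  (forall Z, dg (lrot ev_p v Z) \oc lrot ev_p u Z = t *: idm (j \ox Z)) ->
  s * d_p = t * d_j.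
Proof.
move=> hu hv hs ht.
have nev := mor_nat (ev_mor hp); rewrite /= in nev.
have e : (s * d_p) *: idm U = (t * d_j) *: idm U.
  transitivity (ev_p U \oc (p' |> (dg (rrot co_j v U) \oc rrot co_j u U))
                  \oc dg (ev_p U)).
    by rewrite hs lwZ lw_id compZr mcompm1 compZl (ev_norm hp) scalerA.
  transitivity (dg (co_j U) \oc (dg (lrot ev_p v (j' \ox U))
                  \oc lrot ev_p u (j' \ox U)) \oc co_j U).
    rewrite /rrot /lrot !dag_comp !dagK !lw_dag !dagK !lw_comp -!mcompA.
    rewrite (comp_eqA (nev _ _ _)).
    have := congr1 dg (nev _ _ (dg (co_j U))).
    by rewrite !dag_comp !lw_dag !dagK => ->.
  by rewrite ht compZr mcompm1 compZl (co_norm hj) scalerA.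
exact: (scale_id_inj bU e).
Qed.

(* [xi u] closes the right rotation of u with the strand p; [eta u] is the
   transpose of u, obtained by bending both p and j with [ev_p] and [ev_j]
   and q with [co_q].  They have the same norm, and [eta_xi] bounds that norm
   from below by the norm of u; the same bound for the rotation of u forces
   equality, hence [xi u = eta u]. *)
Let xi u Z : hom Z (q \ox (j' \ox (p' \ox Z))) :=
  rrot co_j u (p' \ox Z) \oc co_p Z.

Let w u Z : hom (j' \ox (p' \ox Z)) (q' \ox Z) :=
  ev_j (q' \ox Z) \oc
  (j' |> (ev_p (j \ox (q' \ox Z)) \oc (p' |> (u (q' \ox Z) \oc co_q Z)))).

Let eta u Z : hom Z (q \ox (j' \ox (p' \ox Z))) := (q |> dg (w u Z)) \oc co_q Z.

Let mor_w u : morph u -> mor (E := W [:: j'; p']) (F := W [:: q']) (w u).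
Proof.
move=> hu.
have h1 := mor_comp (mor_rw (W [:: q']) hu) (co_mor hq).
have h2 := mor_comp (mor_rw (W [:: j; q']) (ev_mor hp)) (mor_lw p' h1).
exact: (mor_comp (mor_rw (W [:: q']) (ev_mor hj)) (mor_lw j' h2)).
Qed.

Let xi_xi u v s :
  (forall Z, dg (rrot co_j v Z) \oc rrot co_j u Z = s *: idm (p \ox Z)) ->
  forall Z, dg (xi v Z) \oc xi u Z = (s * d_p) *: idm Z.
Proof.
move=> hs Z; rewrite /xi dag_comp -mcompA (comp_eqA1 (hs _)).
by rewrite compZl mcomp1m compZr (co_norm hp) scalerA.
Qed.

Let eta_xi u v s : morph u -> morph v ->
  (forall Z, dg (u Z) \oc v Z = s *: idm (q \ox Z)) ->
  forall Z, dg (eta v Z) \oc xi u Z = (s * d_q) *: idm Z.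
Proof.
move=> hu hv hs Z.
have hd := mor_dag (lawful_W [:: q]) (lawful_W [:: p; j]) hu.
have nu := mor_nat hd; rewrite /= in nu.
have ncj := mor_nat (co_mor hj); rewrite /= in ncj.
have ncp := mor_nat (co_mor hp); rewrite /= in ncp.
rewrite /eta /xi /rrot dag_comp lw_dag dagK -!mcompA.
rewrite -(comp_eqA (nu _ _ _)).
suff -> : (p |> j |> w v Z) \oc ((p |> co_j (p' \ox Z)) \oc co_p Z)
      = v (q' \ox Z) \oc co_q Z.
  by rewrite (comp_eqA1 (hs _)) compZl mcomp1m compZr (co_norm hq) scalerA.
rewrite mcompA -lw_comp /w [j |> _]lw_comp -mcompA -ncj.
rewrite (comp_eqA1 (snake_l hj _)) mcomp1m lw_comp -mcompA -ncp.
by rewrite (comp_eqA1 (snake_l hp _)) mcomp1m.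
Qed.

(** [w u] composed with its dagger is a scalar k on the brick q', and closing that strand with
    [co_q] or with [ev_q] gives the same k d_q. On the side of [ev_q] the strand q straightens and
    the left rotation of [u] appears. *)
Let eta_eta u t : morph u ->
  (forall Z, dg (lrot ev_p u Z) \oc lrot ev_p u Z = t *: idm (j \ox Z)) ->
  forall Z, dg (eta u Z) \oc eta u Z = (t * d_j) *: idm Z.
Proof.
move=> hu ht.
have nu := mor_nat hu; rewrite /= in nu.
have nep := mor_nat (ev_mor hp); rewrite /= in nep.
have nej := mor_nat (ev_mor hj); rewrite /= in nej.
have ncq := mor_nat (co_mor hq); rewrite /= in ncq.
have hw := mor_w hu.
have hwd := mor_dag (lawful_W [:: j'; p']) (lawful_W [:: q']) hw.
have hww := mor_scal (lawful_W [:: q']) bq' (mor_comp hw hwd).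
set k := scal _ in hww; rewrite /= in hww.
have ek Z : dg (eta u Z) \oc eta u Z = (k * d_q) *: idm Z.
  have hk : (q |> w u Z) \oc (q |> dg (w u Z)) = k *: idm _.
    by rewrite -lw_comp hww lwZ lw_id.
  rewrite /eta dag_comp lw_dag dagK -mcompA (comp_eqA1 hk).
  by rewrite compZl mcomp1m compZr (co_norm hq) scalerA.
have evw Z : ev_q Z \oc w u (q \ox Z)
    = ev_j Z \oc (j' |> (ev_p (j \ox Z) \oc (p' |> u Z))).
  rewrite /w mcompA -nej -mcompA -lw_comp mcompA -nep -mcompA -lw_comp.
  rewrite mcompA -nu -mcompA.
  by rewrite (snake_l hq) mcompm1.
have e : (k * d_q) *: idm U = (t * d_j) *: idm U.
  transitivity (ev_q U \oc (w u (q \ox U) \oc dg (w u (q \ox U))) \oc dg (ev_q U)).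
    by rewrite hww compZr mcompm1 compZl (ev_norm hq) scalerA.
  rewrite mcompA -mcompA -dag_comp evw dag_comp -mcompA [(j' |> _) \oc _]mcompA.
  rewrite lw_dag -lw_comp dag_comp lw_dag.
  rewrite [_ \oc ((p' |> dg _) \oc _)](_ : _ = t *: idm _); last first.
    by rewrite -ht /lrot dag_comp !lw_dag !dagK -!mcompA.
  by rewrite lwZ lw_id compZl mcomp1m compZr (ev_norm hj) scalerA.
by rewrite -(scale_id_inj bU e).
Qed.

Lemma rrot_ge u s k : morph u ->
  (forall Z, dg (u Z) \oc u Z = s *: idm (q \ox Z)) ->
  (forall Z, dg (rrot co_j u Z) \oc rrot co_j u Z = k *: idm (p \ox Z)) ->
  s * d_q <= k * d_p /\
  (s * d_q = k * d_p -> forall Z, xi u Z = eta u Z).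
Proof.
move=> hu hs hk.
have hl := mor_lrot (ev_mor hp) hu.
have hld := mor_dag (lawful_W [:: j]) (lawful_W [:: p'; q]) hl.
have ht := mor_scal (lawful_W [:: j]) bj (mor_comp hld hl).
set t := scal _ in ht; rewrite /= in ht.
have kt := rrot_lrot hu hu hk ht.
have s0 : s * d_q \is Num.real.
  rewrite rpredM // ?(gtr0_real (dual_pair_gt0 hq)) //.
  have := scal_dag_ge0 D (u U) bq.
  rewrite hs linearZ /= scal_id ?mulr1; last by case: bq.
  by move=> h; apply: ger0_real.
have ex Z : dg (xi u Z) \oc eta u Z = (s * d_q) *: idm Z.
  have := congr1 dg (eta_xi hu hu hs Z).
  by rewrite dag_comp dagK dagZ dag_id (CrealP s0).
(* Both squares equal k d_p, the one of [eta] by [rrot_lrot], and each cross term is - s d_q. *)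
have dE Z : dg (xi u Z - eta u Z) \oc (xi u Z - eta u Z)
    = (2 * (k * d_p - s * d_q)) *: idm Z.
  rewrite dagB compBl !compBr (xi_xi hk) ex (eta_xi hu hu hs) (eta_eta hu ht) -kt.
  rewrite -!scalerBl; congr (_ *: _).
  by ring.
split=> [|e Z].
  have := scal_dag_ge0 D (xi u U - eta u U) bU.
  rewrite dE linearZ /= scal_id ?mulr1; last by case: bU.
  by rewrite pmulr_rge0 ?ltr0n // subr_ge0.
apply/eqP; rewrite -subr_eq0; apply/eqP/(dag_comp_eq0 (D := D)).
by rewrite dE e subrr mulr0 scale0r.
Qed.

(** The assumed bound, opposite to that of [rrot_ge], forces [xi v = eta v]; pairing this single
    identity with [xi u] gives the inner products for all [u]. *)
Lemma rrot_polar :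
  (forall u s k, morph u ->
    (forall Z, dg (u Z) \oc u Z = s *: idm (q \ox Z)) ->
    (forall Z, dg (rrot co_j u Z) \oc rrot co_j u Z = k *: idm (p \ox Z)) ->
    k * d_p <= s * d_q) ->
  forall u v s, morph u -> morph v ->
  (forall Z, dg (u Z) \oc v Z = s *: idm (q \ox Z)) ->
  forall Z, dg (rrot co_j v Z) \oc rrot co_j u Z = (s * d_q / d_p) *: idm (p \ox Z).
Proof.
move=> hle u v s hu hv hs.
have self f : morph f -> exists k,
    forall Z, dg (rrot co_j v Z) \oc rrot co_j f Z = k *: idm (p \ox Z).
  move=> ha.
  have m1 := mor_rrot (co_mor hj) hv.
  have m2 := mor_dag (lawful_W [:: p]) (lawful_W [:: q; j']) m1.
  have m3 := mor_comp m2 (mor_rrot (co_mor hj) ha).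
  by eexists; exact: (mor_scal (lawful_W [:: p]) bp m3).
have [k hk] := self u hu; have [l hl] := self v hv.
have hd := mor_dag (lawful_W [:: q]) (lawful_W [:: p; j]) hv.
have ht := mor_scal (lawful_W [:: q]) bq (mor_comp hd hv).
set t := scal _ in ht; rewrite /= in ht.
have [le1 xe] := rrot_ge hv ht hl.
have {}xe : forall Z, xi v Z = eta v Z.
  by apply: xe; apply/eqP; rewrite eq_le le1 (hle v t l hv ht hl).
have e : (k * d_p) *: idm U = (s * d_q) *: idm U.
  by rewrite -(xi_xi hk) -(eta_xi hu hv hs) xe.
have {}e : k * d_p = s * d_q := scale_id_inj bU e.
move=> Z; rewrite hk; congr (_ *: _); rewrite -e mulfK //.
by rewrite gt_eqF // (dual_pair_gt0 hp).
Qed.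

End Comparison.

Theorem rrot_dot p p' q q' j j' ev_p co_p d_p ev_q co_q d_q ev_j co_j d_j
    (u v : forall Z, hom (q \ox Z) (p \ox (j \ox Z))) s :
  @dual_pair _ C p p' ev_p co_p d_p -> @dual_pair _ C q q' ev_q co_q d_q ->
  @dual_pair _ C j j' ev_j co_j d_j ->
  [/\ brick U, brick (p \ox U), brick (q \ox U) & brick (j \ox U)] ->
  [/\ brick (p' \ox U), brick (q' \ox U) & brick (j' \ox U)] ->
  mor (E := W [:: q]) (F := W [:: p; j]) u ->
  mor (E := W [:: q]) (F := W [:: p; j]) v ->
  (forall Z, dg (u Z) \oc v Z = s *: idm (q \ox Z)) ->
  forall Z, dg (rrot co_j v Z) \oc rrot co_j u Z = (s * d_q / d_p) *: idm (p \ox Z).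
Proof.
move=> hp hq hj [bU bp bq bj] [bp' bq' bj'] hu hv hs.
apply: (rrot_polar hp hq hj bU bp bq bj bq' _ hu hv hs) => a t k ha ht hk.
have ma := mor_rrot (co_mor hj) ha.
have hk' Z : dg (rrot (fun Z => dg (ev_j Z)) (rrot co_j a) Z)
    \oc rrot (fun Z => dg (ev_j Z)) (rrot co_j a) Z = t *: idm (q \ox Z).
  by rewrite !(rrotK hj ha) ht.
by have [] := rrot_ge hq hp (dual_pair_sym hj) bU bp bj' bp' ma hk hk'.
Qed.

(** [rrot_lrot] ties the left rotation to the right one, so no second comparison of norms is
    made. *)
Theorem lrot_dot p p' q q' j j' ev_p co_p d_p ev_q co_q d_q ev_j co_j d_j
    (u v : forall Z, hom (q \ox Z) (p \ox (j \ox Z))) s :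
  @dual_pair _ C p p' ev_p co_p d_p -> @dual_pair _ C q q' ev_q co_q d_q ->
  @dual_pair _ C j j' ev_j co_j d_j ->
  [/\ brick U, brick (p \ox U), brick (q \ox U) & brick (j \ox U)] ->
  [/\ brick (p' \ox U), brick (q' \ox U) & brick (j' \ox U)] ->
  mor (E := W [:: q]) (F := W [:: p; j]) u ->
  mor (E := W [:: q]) (F := W [:: p; j]) v ->
  (forall Z, dg (u Z) \oc v Z = s *: idm (q \ox Z)) ->
  forall Z, dg (lrot ev_p v Z) \oc lrot ev_p u Z = (s * d_q / d_j) *: idm (j \ox Z).
Proof.
move=> hp hq hj bs bs' hu hv hs.
have hr := rrot_dot hp hq hj bs bs' hu hv hs.
have [bU _ _ bj] := bs.
have m1 := mor_lrot (ev_mor hp) hv.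
have m2 := mor_dag (lawful_W [:: j]) (lawful_W [:: p'; q]) m1.
have ht := mor_scal (lawful_W [:: j]) bj (mor_comp m2 (mor_lrot (ev_mor hp) hu)).
set t := scal _ in ht; rewrite /= in ht.
have := rrot_lrot hp hj bU hu hv hr ht.
have dp0 : d_p != 0 by rewrite gt_eqF // (dual_pair_gt0 hp).
have dj0 : d_j != 0 by rewrite gt_eqF // (dual_pair_gt0 hj).
by rewrite divfK // => -> Z; rewrite mulfK.
Qed.
End FrobeniusReciprocity.

(** * Orthonormal bases of hom spaces and multiplicities *)

Section OrthonormalBases.
Variables (R : realType) (C : linearCategory R) (D : starStructure C).
Local Notation dg := (dag D).
Variables (a b : C).
Hypothesis ba : brick a.

Definition orthonormal k (e : 'I_k -> hom a b) :=
  forall i j, dg (e i) \oc e j = (i == j)%:R *: idm a.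

Lemma orthonormal_free k (e : 'I_k -> hom a b) :
  orthonormal e -> free [tuple e i | i < k].
Proof.
move=> oe; apply/freeP => c hc i.
have {}hc : \sum_j c j *: e j = 0.
  by rewrite -[RHS]hc; apply: eq_bigr => j _; rewrite nth_mktuple.
have [n0 _] := ba.
have := congr1 (fun f => dg (e i) \oc f) hc.
rewrite /= comp_sumr compm0 (bigD1 i) //= big1 => [|j ji]; last first.
  rewrite compZr oe eq_sym (negbTE ji).
  by rewrite scale0r scaler0.
rewrite addr0 compZr oe eqxx scale1r => /eqP.
by rewrite scaler_eq0 (negbTE n0) orbF => /eqP.
Qed.

(** One Gram-Schmidt step: the part of [f] that the family misses is normalised and appended. *)
Lemma orthonormal_extend k (e : 'I_k -> hom a b) (f : hom a b) :
  orthonormal e -> f != \sum_i (e i \oc (dg (e i) \oc f)) ->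
  exists e' : 'I_k.+1 -> hom a b, orthonormal e'.
Proof.
move=> oe nf; set g := f - \sum_i (e i \oc (dg (e i) \oc f)).
have g0 : g != 0 by rewrite subr_eq0.
have eg i : dg (e i) \oc g = 0.
  rewrite compBr comp_sumr (bigD1 i) //= big1 => [|j ji]; last first.
    by rewrite mcompA oe eq_sym (negbTE ji) scale0r comp0m.
  by rewrite mcompA oe eqxx scale1r mcomp1m addr0 subrr.
have ge i : dg g \oc e i = 0.
  by rewrite -[e i](dagK D) -dag_comp eg dag0.
set s := scal (dg g \oc g).
have s0 : 0 < s.
  rewrite lt0r scal_dag_ge0 // andbT; apply: contraNneq g0 => h.
  by apply/eqP/(scal_dag_eq0 (D := D)).
have gg : dg g \oc g = s *: idm a by exact: scalE.
pose r := (sqrtC s)^-1.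
have rr : r^* = r by apply/CrealP/ger0_real; rewrite invr_ge0 sqrtC_ge0 ltW.
exists (fun i => if unlift ord_max i is Some j then e j else r *: g) => i j.
case: unliftP => [i'|] ->; case: unliftP => [j'|] ->.
- by rewrite oe (inj_eq lift_inj).
- by rewrite compZr eg eq_sym (negbTE (neq_lift _ _)) scale0r scaler0.
- by rewrite dagZ compZl ge (negbTE (neq_lift _ _)) scale0r scaler0.
rewrite eqxx dagZ rr compZl compZr gg !scalerA; congr (_ *: _).
by rewrite -invfM -expr2 sqrtCK mulVf // gt_eqF.
Qed.

(** The empty family is extended until nothing is missed; orthonormal families are free, so the
    dimension bounds the number of steps. *)
Lemma orthonormal_basis : exists e : 'I_(\dim {: hom a b}) -> hom a b,
  orthonormal e /\ forall f : hom a b, f = \sum_i (e i \oc (dg (e i) \oc f)).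
Proof.
have step n : forall k (e : 'I_k -> hom a b), orthonormal e ->
    (\dim {: hom a b} - k = n)%N ->
    exists k' (e' : 'I_k' -> hom a b), orthonormal e' /\
      forall f : hom a b, f = \sum_i (e' i \oc (dg (e' i) \oc f)).
  elim: n => [|n IH] k e oe hk.
    exists k, e; split=> // f; apply/eqP/negP => /negP nf.
    have [e' oe'] := orthonormal_extend oe nf.
    have := orthonormal_free oe'; rewrite /free size_tuple => /eqP h.
    have := dimvS (subvf (span [tuple e' i | i < k.+1])).
    by rewrite h leqNgt ltnS -subn_eq0 hk eqxx.
  have [h|] := pselect (forall f : hom a b, f = \sum_i (e i \oc (dg (e i) \oc f))).
    by exists k, e.
  move=> /existsNP [f /eqP nf].
  have [e' oe'] := orthonormal_extend oe nf.
  by apply: (IH _ _ oe'); rewrite subnS hk.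
have [|k [e [oe he]]] := step _ 0%N (fun=> 0) _ (erefl _).
  by case.
suff kd : k = \dim {: hom a b} by subst k; exists e.
have := orthonormal_free oe; rewrite /free size_tuple => /eqP <-.
congr (\dim _); apply/eqP; rewrite eqEsubv subvf /=.
apply/subvP => f _; rewrite [f]he; apply: memv_suml => i _.
have [_ /(_ (dg (e i) \oc f)) [c ->]] := ba.
rewrite compZr mcompm1 memvZ // memv_span //=.
by rewrite -[e i](tnth_mktuple e) mem_tnth.
Qed.

End OrthonormalBases.

(** By Schur's lemma a map from [S q] has zero components on the other simple summands and scalar
    ones on the copies of [S q], whose injections thus form a basis. *)
Lemma direct_sum_dim (R : realType) (C : linearCategory R) m
    (S : 'I_m -> C) (N : 'I_m -> nat) (Y : C) (q : 'I_m) :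
  abelian_category C -> simple_classes S ->
  is_direct_sum (fun p : {s : 'I_m & 'I_(N s)} => S (tag p)) Y ->
  \dim {: hom (S q) Y} = N q.
Proof.
move=> abC [simS injS _] [inj [proj [pi pi0 ip]]].
have bq := simple_brick abC (simS q).
pose b (i : 'I_(N q)) : hom (S q) Y := inj (Tagged (fun s => 'I_(N s)) i).
have fb : free [tuple b i | i < N q].
  apply/freeP => c hc i.
  have {}hc : \sum_j c j *: b j = 0.
    by rewrite -[RHS]hc; apply: eq_bigr => j _; rewrite nth_mktuple.
  have [n0 _] := bq.
  have := congr1 (fun f => proj (Tagged (fun s => 'I_(N s)) i) \oc f) hc.
  rewrite /= comp_sumr compm0 (bigD1 i) //= big1 => [|j ji]; last first.
    have -> : proj (Tagged (fun s => 'I_(N s)) i) \oc c j *: b j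
        = c j *: (proj (Tagged _ i) \oc inj (Tagged _ j)) by rewrite compZr.
    rewrite pi0 ?scaler0 //; apply: contraNneq ji => /eqP.
    by rewrite eq_Tagged /= eq_sym.
  have -> : proj (Tagged (fun s => 'I_(N s)) i) \oc c i *: b i
      = c i *: (proj (Tagged _ i) \oc inj (Tagged _ i)) by rewrite compZr.
  rewrite addr0 pi => /eqP.
  by rewrite scaler_eq0 (negbTE n0) orbF => /eqP.
have := fb; rewrite /free size_tuple => /eqP <-.
congr (\dim _); apply/esym/eqP; rewrite eqEsubv subvf /=.
apply/subvP => f _; rewrite -[f]mcomp1m -ip comp_suml; apply: memv_suml => -[s i] _.
rewrite -mcompA; have [e|ne] := eqVneq s q; last first.
  rewrite [proj _ \oc f](_ : _ = 0) ?compm0 ?mem0v //.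
  apply/eqP/negP => /negP h; case/eqP: ne; apply: injS.
  have [g [g1 g2]] := simple_hom_iso abC (simS q) (simS s) h.
  by exists g, (proj (existT _ s i) \oc f).
subst s.
have [_ /(_ (proj (existT _ q i) \oc f)) [c e]] := bq.
rewrite /= in e; rewrite e compZr mcompm1 memvZ // memv_span //=.
by rewrite -[inj _](tnth_mktuple b i) mem_tnth.
Qed.

(** * Vertices, quantum dimensions and fusion coefficients *)

Section FusionCategory.
Variables (R : realType) (C : unitaryFusionCategory R) (m : nat).
Variables (S : 'I_m.+1 -> C) (G : fusionData m).
Hypothesis hG : is_grothendieck_ring S G.
Let M := ufc_tens C.
Let D := ufc_star C.
Implicit Types Z Y : C.
Implicit Types p q r s i j k l n : 'I_m.+1.
Local Notation dg := (dag D).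
Local Notation U := (tunit M).
Local Notation "a \ox b" := (tens M a b) (at level 40, left associativity).
Local Notation "a |> f" := (tensm M (idm a) f)
  (at level 45, right associativity).
Local Notation N := (fcoef G).
Local Notation "j ^v" := (fdual G j) (at level 2, format "j ^v").

Lemma simple_S j : simple_object (S j).
Proof. by case: (gr_classes hG) => + _ _; apply. Qed.

Lemma brick_S j : brick (S j).
Proof. exact: (simple_brick (ufc_abelian C) (simple_S j)). Qed.

Lemma brick_U : brick U.
Proof. by have [f fi] := gr_unit hG; apply: (brick_iso fi (brick_S ord0)). Qed.

Lemma brick_SU j : brick (S j \ox U).
Proof.
have [g [g1 g2]] := runit_iso M (S j).
by apply: (brick_iso (f := g) _ (brick_S j)); exists (runit M (S j)).
Qed.

Lemma fcoef_dim p j q : \dim {: hom (S q) (S p \ox S j)} = N p j q.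
Proof.
exact: (direct_sum_dim (N := N p j) q (ufc_abelian C) (gr_classes hG)
  (gr_coef hG p j)).
Qed.

Lemma vertex_exists p j q : exists e : 'I_(N p j q) -> hom (S q) (S p \ox S j),
  orthonormal D e /\ forall f : hom (S q) (S p \ox S j),
    f = \sum_i (e i \oc (dg (e i) \oc f)).
Proof.
by have := orthonormal_basis D (S p \ox S j) (brick_S q); rewrite fcoef_dim.
Qed.

Definition vertex p j q := projT1 (cid (vertex_exists p j q)).

Lemma vertex_dot p j q u v :
  dg (@vertex p j q u) \oc vertex v = (u == v)%:R *: idm (S q).
Proof. exact: (proj1 (projT2 (cid (vertex_exists p j q)))). Qed.

Lemma vertex_expand p j q (f : hom (S q) (S p \ox S j)) :
  f = \sum_u (@vertex p j q u \oc (dg (vertex u) \oc f)).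
Proof. exact: (proj2 (projT2 (cid (vertex_exists p j q)))). Qed.

Lemma hom_S_neq q q' (f : hom (S q) (S q')) : q != q' -> f = 0.
Proof.
move=> ne; apply/eqP/negP => /negP nf; case/eqP: ne.
have [_ + _] := gr_classes hG; apply.
by exists f; apply: (simple_hom_iso (ufc_abelian C) (simple_S q) (simple_S q')).
Qed.

(** The injections of the biproduct need not be isometric and only serve to test the identity: on an
    injection of [S q], the vertices of channel q reproduce it and those of the other channels
    vanish. *)
Lemma vertex_sum p j : \sum_q \sum_u (@vertex p j q u \oc dg (vertex u)) = idm _.
Proof.
have [inj [proj [_ _ ip]]] := gr_coef hG p j.
rewrite -[LHS]mcompm1 -ip comp_sumr; apply: eq_bigr => -[q i] _ /=.
rewrite mcompA; congr (_ \oc _).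
rewrite [RHS]vertex_expand comp_suml (bigD1 q) //= [X in _ + X]big1 ?addr0.
  by rewrite comp_suml; apply: eq_bigr => u _; rewrite mcompA.
move=> q' ne; rewrite comp_suml big1 // => u _.
by rewrite -mcompA (hom_S_neq (dg _ \oc _)) ?compm0 // eq_sym.
Qed.

Lemma mor_neq q q' (f : forall Z, hom (S q \ox Z) (S q' \ox Z)) : q != q' ->
  mor (E := W [:: S q]) (F := W [:: S q']) f -> forall Z, f Z = 0.
Proof.
move=> ne hf.
have h0 := mor_scale 0 hf.
have fU : f U = 0 *: f U.
  have [g [g1 g2]] := runit_iso M (S q).
  have [g' [g1' g2']] := runit_iso M (S q').
  rewrite scale0r -[f U]mcompm1 -g1 -[X in X \oc _]mcomp1m -g1' -!mcompA.
  rewrite [f U \oc _]mcompA [runit _ _ \oc _]mcompA.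
  by rewrite (hom_S_neq (runit M (S q') \oc (f U \oc g))) // comp0m compm0.
by move=> Z; rewrite (mor_unit_inj (lawful_W [:: S q]) hf h0 fU) scale0r.
Qed.

Lemma mor_S q (f : forall Z, hom (S q \ox Z) (S q \ox Z)) :
  mor (E := W [:: S q]) (F := W [:: S q]) f ->
  forall Z, f Z = scal (f U) *: idm _.
Proof. exact: (mor_scal (lawful_W [:: S q]) (brick_SU q)). Qed.

Definition vtx p j q (u : 'I_(N p j q)) Z : hom (S q \ox Z) (S p \ox (S j \ox Z)) :=
  associator M (S p) (S j) Z \oc tensm M (vertex u) (idm Z).

Lemma mor_vtx p j q u : mor (E := W [:: S q]) (F := W [:: S p; S j]) (@vtx p j q u).
Proof. exact: mor_tm2. Qed.

Lemma vtx_dot p j q u v Z : dg (@vtx p j q u Z) \oc vtx v Z = (u == v)%:R *: idm _.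
Proof.
rewrite /vtx dag_comp -mcompA (comp_eqA1 (dag_assocK _ _ _)) mcomp1m tm_dagl.
by rewrite -tm_comp_l vertex_dot tmZl tensm1.
Qed.

Lemma vtx_sum p j Z : \sum_q \sum_u (@vtx p j q u Z \oc dg (vtx u Z)) = idm _.
Proof.
transitivity (associator M (S p) (S j) Z
    \oc tensm M (\sum_q \sum_u (@vertex p j q u \oc dg (vertex u))) (idm Z)
    \oc dg (associator M (S p) (S j) Z)).
  rewrite tm_suml comp_sumr comp_suml; apply: eq_bigr => q _.
  rewrite tm_suml comp_sumr comp_suml; apply: eq_bigr => u _.
  by rewrite /vtx dag_comp tm_dagl tm_comp_l !mcompA.
by rewrite vertex_sum tensm1 mcompm1 assoc_dagK.
Qed.

Lemma dual_exists j : exists ev co d, @dual_pair _ C (S j) (S j^v) ev co d.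
Proof. exact: (left_dual_pair brick_U (brick_SU j) (gr_dual hG j)). Qed.

Definition ev j := projT1 (cid (dual_exists j)).
Definition co j := projT1 (cid (projT2 (cid (dual_exists j)))).
(** The common norm of the chosen duality; through [fpdim_fbasis] it will be the Frobenius-Perron
    dimension. *)
Definition qdim j := projT1 (cid (projT2 (cid (projT2 (cid (dual_exists j)))))).

Lemma dualP j : dual_pair (ev j) (co j) (qdim j).
Proof. exact: (projT2 (cid (projT2 (cid (projT2 (cid (dual_exists j))))))). Qed.

Lemma qdim_gt0 j : 0 < qdim j. Proof. exact: (dual_pair_gt0 (dualP j)). Qed.

Lemma qdim_neq0 j : qdim j != 0. Proof. by rewrite gt_eqF ?qdim_gt0. Qed.

Lemma mor_dag_W v w (f : forall Z, hom (W v Z) (W w Z)) :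
  mor (E := W v) (F := W w) f -> mor (E := W w) (F := W v) (fun Z => dg (f Z)).
Proof. exact: (mor_dag (lawful_W v) (lawful_W w)). Qed.

Section Rotation.
Variables (p q j : 'I_m.+1) (u v : forall Z, hom (S q \ox Z) (S p \ox (S j \ox Z))).
Variable s : (R[i])%C.
Hypotheses (hu : mor (E := W [:: S q]) (F := W [:: S p; S j]) u)
           (hv : mor (E := W [:: S q]) (F := W [:: S p; S j]) v).
Hypothesis hs : forall Z, dg (u Z) \oc v Z = s *: idm (S q \ox Z).

Lemma rrot_dotS Z :
  dg (rrot (co j) v Z) \oc rrot (co j) u Z = (s * qdim q / qdim p) *: idm _.
Proof.
apply: (rrot_dot (dualP p) (dualP q) (dualP j) _ _ hu hv hs).
- by split; [exact: brick_U|exact: brick_SU..].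
- by split; exact: brick_SU.
Qed.

Lemma lrot_dotS Z :
  dg (lrot (ev p) v Z) \oc lrot (ev p) u Z = (s * qdim q / qdim j) *: idm _.
Proof.
apply: (lrot_dot (dualP p) (dualP q) (dualP j) _ _ hu hv hs).
- by split; [exact: brick_U|exact: brick_SU..].
- by split; exact: brick_SU.
Qed.

End Rotation.

(* For every simple source n, [y n] is a basis of Hom(S n, w), orthonormal for
   the inner product [scal (dg f \oc g)]. *)
Definition onb (w : seq C) (A : 'I_m.+1 -> finType)
    (y : forall n, A n -> forall Z, hom (S n \ox Z) (W w Z)) : Prop :=
  [/\ forall n a, mor (E := W [:: S n]) (F := W w) (y n a),
      forall n a b Z, dg (y n a Z) \oc y n b Z = (a == b)%:R *: idm _
    & forall Z, \sum_n \sum_a (y n a Z \oc dg (y n a Z)) = idm (W w Z)].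

(** Basis independence of the trace of a sesquilinear form. Applied to the two bracketings of three
    strands, it replaces explicit recoupling matrices. *)
Lemma onb_form w A y B z n
    (phi : hom (S n \ox U) (W w U) -> hom (S n \ox U) (W w U) -> (R[i])%C) :
  @onb w A y -> @onb w B z ->
  (forall (J : finType) c (f : J -> hom (S n \ox U) (W w U)) g,
     phi (\sum_i c i *: f i) g = \sum_i (c i)^* * phi (f i) g) ->
  (forall (J : finType) c (f : J -> hom (S n \ox U) (W w U)) g,
     phi g (\sum_i c i *: f i) = \sum_i c i * phi g (f i)) ->
  \sum_(a : A n) phi (y n a U) (y n a U) = \sum_(b : B n) phi (z n b U) (z n b U).
Proof.
move=> [my dy sy] [mz dz sz] phil phir.
pose c (a : A n) (b : B n) := scal (dg (y n a U) \oc z n b U).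
have cE a b : dg (y n a U) \oc z n b U = c a b *: idm _.
  exact: (scalE _ (brick_SU n)).
have cE' a b : dg (z n b U) \oc y n a U = (c a b)^* *: idm _.
  have := congr1 dg (cE a b); by rewrite dag_comp dagK dagZ dag_id.
have zE b : z n b U = \sum_a c a b *: y n a U.
  rewrite -[LHS]mcomp1m -sy comp_suml (bigD1 n) //= [X in _ + X]big1 ?addr0.
    rewrite comp_suml; apply: eq_bigr => a _.
    by rewrite -mcompA cE compZr mcompm1.
  move=> n' ne; rewrite comp_suml big1 // => a _.
  rewrite -mcompA.
  have h := mor_comp (mor_dag (lawful_W [:: S n']) (lawful_W w) (my n' a)) (mz n b).
  by rewrite (mor_neq _ h U) ?compm0 // eq_sym.
have yE a : y n a U = \sum_b (c a b)^* *: z n b U.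
  rewrite -[LHS]mcomp1m -sz comp_suml (bigD1 n) //= [X in _ + X]big1 ?addr0.
    rewrite comp_suml; apply: eq_bigr => b _.
    by rewrite -mcompA cE' compZr mcompm1.
  move=> n' ne; rewrite comp_suml big1 // => b _.
  rewrite -mcompA.
  have h := mor_comp (mor_dag (lawful_W [:: S n']) (lawful_W w) (mz n' b)) (my n a).
  by rewrite (mor_neq _ h U) ?compm0 // eq_sym.
transitivity (\sum_(a : A n) \sum_(b : B n) c a b * phi (z n b U) (y n a U)).
  apply: eq_bigr => a _; rewrite {1}yE phil; apply: eq_bigr => b _.
  by rewrite conjCK.
rewrite exchange_big; apply: eq_bigr => b _.
by have := phir _ (c^~ b) (fun a => y n a U) (z n b U); rewrite -zE => ->.
Qed.


(** The trace of the inner product itself counts the basis. *)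
Lemma onb_card w A y B z n : @onb w A y -> @onb w B z -> #|A n| = #|B n|.
Proof.
move=> hy hz.
have := onb_form (n := n) (phi := fun f g => scal (dg f \oc g)) hy hz.
have [_ dy _] := hy; have [_ dz _] := hz.
have one : scal (idm (S n \ox U)) = 1 by apply: scal_id; case: (brick_SU n).
move=> h.
have {}h : \sum_(a : A n) (1 : (R[i])%C) = \sum_(b : B n) 1.
  transitivity (\sum_(b : B n) scal (dg (z n b U) \oc z n b U)); last first.
    by apply: eq_bigr => b _; rewrite dz eqxx scale1r.
  rewrite -h => [|J c f g|J c f g].
  - by apply: eq_bigr => a _; rewrite dy eqxx scale1r.
  - rewrite dag_sum comp_suml linear_sum; apply: eq_bigr => i _.
    by rewrite dagZ compZl linearZ.
  - rewrite comp_sumr linear_sum; apply: eq_bigr => i _.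
    by rewrite compZr linearZ.
by apply/eqP; move/eqP: h; rewrite !sumr_const eqr_nat.
Qed.

Lemma onb_vtx p j : onb (w := [:: S p; S j]) (@vtx p j).
Proof.
split=> [n u|n u v Z|Z]; [exact: mor_vtx|exact: vtx_dot|exact: vtx_sum].
Qed.

(* The factor makes the right rotations of an orthonormal basis orthonormal. *)
Definition rvtx q j n (u : 'I_(N n j q)) Z : hom (S n \ox Z) (S q \ox (S j^v \ox Z)) :=
  sqrtC (qdim n / qdim q) *: rrot (co j) (vtx u) Z.

Lemma mor_rvtx q j n u : mor (E := W [:: S n]) (F := W [:: S q; S j^v]) (@rvtx q j n u).
Proof. exact/mor_scale/mor_rrot/mor_vtx/(co_mor (dualP j)). Qed.

Lemma sqrt_ratio_conj n q : (sqrtC (qdim n / qdim q))^* = sqrtC (qdim n / qdim q).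
Proof.
by apply/CrealP/ger0_real; rewrite sqrtC_ge0 divr_ge0 // ltW ?qdim_gt0.
Qed.

Lemma rvtx_dot q j n u v Z : dg (@rvtx q j n u Z) \oc rvtx v Z = (u == v)%:R *: idm _.
Proof.
rewrite /rvtx dagZ compZl compZr scalerA sqrt_ratio_conj -expr2 sqrtCK.
have h Z' : dg (vtx v Z') \oc vtx u Z' = (u == v)%:R *: idm _.
  by rewrite vtx_dot eq_sym.
rewrite (rrot_dotS (mor_vtx v) (mor_vtx u) h) scalerA; congr (_ *: _).
by field; rewrite !qdim_neq0.
Qed.

(** Completeness is obtained without counting, so that [fcoef_frob] can follow from it: each vertex
    is the rotation of its own inverse rotation, which expands in vertices, hence it is fixed by the
    projection P onto the rotated vertices. *)
Lemma onb_rvtx q j : onb (w := [:: S q; S j^v]) (@rvtx q j).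
Proof.
split=> [n u|n u v Z|Z]; [exact: mor_rvtx|exact: rvtx_dot|].
rewrite -[LHS]mcompm1 -(vtx_sum q j^v Z) comp_sumr; apply: eq_bigr => n _.
rewrite comp_sumr; apply: eq_bigr => v _; rewrite mcompA; congr (_ \oc _).
set P := (X in X \oc _ = _).
have PV n' u : P \oc @rvtx q j n' u Z = rvtx u Z.
  rewrite /P comp_suml (bigD1 n') //= [X in _ + X]big1 ?addr0 => [|k kn]; last first.
    rewrite comp_suml big1 // => u' _; rewrite -mcompA.
    have h := mor_comp (mor_dag_W (mor_rvtx u')) (mor_rvtx u).
    by rewrite (mor_neq _ h) ?compm0 // eq_sym.
  rewrite comp_suml (bigD1 u) //= [X in _ + X]big1 ?addr0 => [|u' ne].
    by rewrite -mcompA rvtx_dot eqxx scale1r mcompm1.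
  by rewrite -mcompA rvtx_dot (negbTE ne) scale0r compm0.
have PR u : P \oc rrot (co j) (@vtx n j q u) Z = rrot (co j) (vtx u) Z.
  have := PV n u; rewrite /rvtx compZr => /(scalerI _); apply.
  by rewrite sqrtC_eq0 mulf_neq0 ?invr_neq0 ?qdim_neq0.
pose r := rrot (fun Z => dg (ev j Z)) (vtx v).
have mr : mor (E := W [:: S q]) (F := W [:: S n; S j]) r.
  exact: (mor_rrot (co_mor (dual_pair_sym (dualP j))) (mor_vtx v)).
have rK : rrot (co j) r Z = vtx v Z.
  by have := rrotK (dual_pair_sym (dualP j)) (mor_vtx v) Z; rewrite /rrot dagK.
have rE Z' : r Z' = \sum_u scal (dg (@vtx n j q u U) \oc r U) *: vtx u Z'.
  rewrite -[LHS]mcomp1m -vtx_sum comp_suml (bigD1 q) //= [X in _ + X]big1 ?addr0.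
    rewrite comp_suml; apply: eq_bigr => u _; rewrite -mcompA.
    have h := mor_comp (mor_dag_W (mor_vtx u)) mr.
    by rewrite (mor_S h) compZr mcompm1.
  move=> k kq; rewrite comp_suml big1 // => u _; rewrite -mcompA.
  have h := mor_comp (mor_dag_W (mor_vtx u)) mr.
  by rewrite (mor_neq _ h) ?compm0 // eq_sym.
rewrite -rK /rrot rE dag_sum comp_suml comp_sumr; apply: eq_bigr => u _.
by rewrite dagZ compZl compZr PR.
Qed.

Section CompositeBases.
Variables (x1 x2 x3 : C) (A : 'I_m.+1 -> finType).

(** Trees that fuse the first two strands first; [onb_comp_r] gives the other bracketing of the same
    space. *)
Lemma onb_comp_l (B : 'I_m.+1 -> 'I_m.+1 -> finType) y z :
  onb (w := [:: x1; x2]) (A := A) y ->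
  (forall r, onb (w := [:: S r; x3]) (A := B r) (z r)) ->
  onb (w := [:: x1; x2; x3]) (A := fun n => {r : 'I_m.+1 & (A r * B r n)%type})
    (fun n t Z => y (tag t) (tagged t).1 (x3 \ox Z) \oc z (tag t) n (tagged t).2 Z).
Proof.
move=> [my dy sy] hz; split.
- move=> n [r [a b]] /=; have [mz _ _] := hz r.
  exact: (mor_comp (mor_rw (W [:: x3]) (my r a)) (mz n b)).
- move=> n [r [a b]] [r' [a' b']] Z /=; have [mz dz _] := hz r.
  rewrite dag_comp -mcompA [dg (y _ _ _) \oc _]mcompA.
  have [e|ne] := eqVneq r r'; last first.
    have h := mor_comp (mor_dag_W (my r a)) (my r' a').
    rewrite eq_sym in ne; rewrite (mor_neq ne h) comp0m compm0.
    rewrite -[_ == _]/(_ && _) /= eq_sym (negbTE ne) scale0r //.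
  subst r'; rewrite dy compZl mcomp1m compZr dz scalerA -natrM mulnb.
  by rewrite -[in RHS]/(Tagged _ (a, b) == Tagged _ (a', b')) eq_Tagged.
- move=> Z; rewrite -sy.
  transitivity (\sum_r \sum_(a : A r) (y r a (x3 \ox Z) \oc (\sum_n \sum_(b : B r n)
      (z r n b Z \oc dg (z r n b Z))) \oc dg (y r a (x3 \ox Z)))); last first.
    apply: eq_bigr => r _; apply: eq_bigr => a _; have [_ _ ->] := hz r.
    by rewrite mcompm1.
  transitivity (\sum_n \sum_r \sum_(a : A r) \sum_(b : B r n)
     (y r a (x3 \ox Z) \oc (z r n b Z \oc dg (z r n b Z)) \oc dg (y r a (x3 \ox Z)))).
    apply: eq_bigr => n _.
    rewrite (eq_bigr _ (fun r _ => pair_big _ _ _)) sig_big_dep /=.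
    apply: eq_bigr => -[r [a b]] _ /=.
    by rewrite dag_comp !mcompA.
  rewrite exchange_big; apply: eq_bigr => r _.
  rewrite exchange_big; apply: eq_bigr => a _.
  rewrite comp_sumr comp_suml; apply: eq_bigr => n _.
  by rewrite comp_sumr comp_suml; apply: eq_bigr.
Qed.

Lemma onb_comp_r (B : 'I_m.+1 -> 'I_m.+1 -> finType) y z :
  onb (w := [:: x2; x3]) (A := A) y ->
  (forall r, onb (w := [:: x1; S r]) (A := B r) (z r)) ->
  onb (w := [:: x1; x2; x3]) (A := fun n => {r : 'I_m.+1 & (A r * B r n)%type})
    (fun n t Z => (x1 |> y (tag t) (tagged t).1 Z) \oc z (tag t) n (tagged t).2 Z).
Proof.
move=> [my dy sy] hz; split.
- move=> n [r [a b]] /=; have [mz _ _] := hz r.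
  exact: (mor_comp (mor_lw x1 (my r a)) (mz n b)).
- move=> n [r [a b]] [r' [a' b']] Z /=; have [mz dz _] := hz r.
  rewrite dag_comp -mcompA [dg (_ |> _) \oc _]mcompA lw_dag -lw_comp.
  have [e|ne] := eqVneq r r'; last first.
    have h := mor_comp (mor_dag_W (my r a)) (my r' a').
    rewrite eq_sym in ne; rewrite (mor_neq ne h) lw0 comp0m compm0.
    rewrite -[_ == _]/(_ && _) /= eq_sym (negbTE ne) scale0r //.
  subst r'; rewrite dy lwZ lw_id compZl mcomp1m compZr dz scalerA -natrM mulnb.
  by rewrite -[in RHS]/(Tagged _ (a, b) == Tagged _ (a', b')) eq_Tagged.
- move=> Z; rewrite -[RHS]lw_id -sy lw_sum.
  transitivity (\sum_r \sum_(a : A r) ((x1 |> y r a Z) \oc (\sum_n \sum_(b : B r n)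
      (z r n b Z \oc dg (z r n b Z))) \oc dg (x1 |> y r a Z))); last first.
    apply: eq_bigr => r _; rewrite lw_sum; apply: eq_bigr => a _; have [_ _ ->] := hz r.
    by rewrite mcompm1 lw_dag -lw_comp.
  transitivity (\sum_n \sum_r \sum_(a : A r) \sum_(b : B r n)
     ((x1 |> y r a Z) \oc (z r n b Z \oc dg (z r n b Z)) \oc dg (x1 |> y r a Z))).
    apply: eq_bigr => n _.
    rewrite (eq_bigr _ (fun r _ => pair_big _ _ _)) sig_big_dep /=.
    apply: eq_bigr => -[r [a b]] _ /=.
    by rewrite dag_comp !mcompA.
  rewrite exchange_big; apply: eq_bigr => r _.
  rewrite exchange_big; apply: eq_bigr => a _.
  rewrite comp_sumr comp_suml; apply: eq_bigr => n _.
  by rewrite comp_sumr comp_suml; apply: eq_bigr.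
Qed.

End CompositeBases.


Lemma card_pair_sig (A B : 'I_m.+1 -> finType) :
  #|{: {r : 'I_m.+1 & (A r * B r)%type}}| = (\sum_r #|A r| * #|B r|)%N.
Proof.
rewrite -sum1_card -(sig_big_dep xpredT (fun r => xpredT) (fun r t => 1%N)).
by apply: eq_bigr => r _; rewrite sum1_card card_prod.
Qed.

(** Both sides count an orthonormal basis of Hom(S_n, S_p (x) S_i (x) S_k). *)
Lemma fcoefA p i k n :
  (\sum_r N p i r * N r k n = \sum_s N i k s * N p s n)%N.
Proof.
have := onb_card n (onb_comp_l (onb_vtx p i) (fun r => onb_vtx r k))
  (onb_comp_r (onb_vtx i k) (fun s => onb_vtx p s)).
rewrite (card_pair_sig (fun r => 'I_(N p i r)) (fun r => 'I_(N r k n))).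
rewrite (card_pair_sig (fun s => 'I_(N i k s)) (fun s => 'I_(N p s n))).
under eq_bigr do rewrite !card_ord.
by under [RHS]eq_bigr do rewrite !card_ord.
Qed.

Lemma fcoef_frob n j q : N n j q = N q j^v n.
Proof. by have := onb_card n (onb_rvtx q j) (onb_vtx q j^v); rewrite !card_ord. Qed.

Lemma dim_hom_S s j : \dim {: hom (S s) (S j)} = (s == j).
Proof.
have [<-|ne] := eqVneq s j.
  have [n0 h] := brick_S s.
  have -> : {: hom (S s) (S s)}%VS = <[idm (S s)]>%VS.
    apply/eqP; rewrite eqEsubv subvf andbT; apply/subvP => f _.
    by have [k ->] := h f; rewrite memvZ // memv_line.
  by rewrite dim_vline n0.
apply/eqP; rewrite dimv_eq0 -subv0; apply/subvP => f _.
by rewrite (hom_S_neq f ne) mem0v.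
Qed.

Lemma iso_sym (a b : C) (f : hom a b) : is_iso f -> exists g : hom b a, is_iso g.
Proof. by case=> g [g1 g2]; exists g, f. Qed.

Lemma fcoef0l j s : N ord0 j s = (s == j).
Proof.
have [f fi] := gr_unit hG; have [f' fi'] := iso_sym fi.
have li := lunit_iso M (S j); have [l li'] := iso_sym li.
rewrite -fcoef_dim -dim_hom_S; apply/eqP; rewrite eqn_leq.
have h := comp_iso li (tm_iso fi (id_iso (S j))).
have h' := comp_iso (tm_iso fi' (id_iso (S j))) li'.
by rewrite (hom_iso_dim (id_iso _) h) (hom_iso_dim (id_iso _) h').
Qed.

Lemma fcoef0r j s : N j ord0 s = (s == j).
Proof.
have [f fi] := gr_unit hG; have [f' fi'] := iso_sym fi.
have li := runit_iso M (S j); have [l li'] := iso_sym li.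
rewrite -fcoef_dim -dim_hom_S; apply/eqP; rewrite eqn_leq.
have h := comp_iso li (tm_iso (id_iso (S j)) fi).
have h' := comp_iso (tm_iso (id_iso (S j)) fi') li'.
by rewrite (hom_iso_dim (id_iso _) h) (hom_iso_dim (id_iso _) h').
Qed.

(** Insert the resolution of the identity of S_p (x) S_j into a closed strand j beside p: each
    vertex of channel q contributes the squared norm of its right rotation, d_q / d_p. *)
Lemma qdimM p j : qdim p * qdim j = \sum_q (N p j q)%:R * qdim q.
Proof.
have : qdim j *: idm (S p \ox U)
    = (\sum_q (N p j q)%:R * (qdim q / qdim p)) *: idm (S p \ox U).
  have h : (S p |> dg (co j U)) \oc (S p |> co j U) = qdim j *: idm (S p \ox U).
    by rewrite -lw_comp (co_norm (dualP j)) lwZ lw_id.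
  rewrite -h -[S p |> co j U]mcomp1m -vtx_sum comp_suml comp_sumr scaler_suml.
  apply: eq_bigr => q _; rewrite comp_suml comp_sumr.
  rewrite (eq_bigr (fun=> (qdim q / qdim p) *: idm (S p \ox U))) => [|u _].
    by rewrite sumr_const card_ord -scaler_nat scalerA.
  have e := rrot_dotS (mor_vtx u) (mor_vtx u) (vtx_dot u u) U.
  move: e; rewrite eqxx mul1r /rrot dag_comp dagK lw_dag => <-.
  by rewrite !mcompA.
move=> /(scale_id_inj (brick_SU p)) ->.
rewrite mulr_sumr; apply: eq_bigr => q _.
by field; rewrite qdim_neq0.
Qed.

(** * The star-representation attached to an object *)

Section PositiveAction.
Variables (x x' : C).
Variable T : forall p Z, hom (S p \ox Z) (x \ox (x' \ox (S p \ox Z))).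
Hypothesis mT : forall p,
  mor (E := W [:: S p]) (F := W [:: x; x'; S p]) (T p).

(* [\sum_p \sum_u act u] is the action of the basis element x_j on the
   vectors T of the direct sum over p of Hom(S p, x x' (S p)); [act_adjoint]
   and [act_gram] make it a star-representation. *)
Definition act p j q (u : 'I_(N p j q)) Z :
    hom (S q \ox Z) (x \ox (x' \ox (S q \ox Z))) :=
  (x |> x' |> dg (vtx u Z)) \oc (T p (S j \ox Z) \oc vtx u Z).

Lemma mor_act p j q (u : 'I_(N p j q)) :
  mor (E := W [:: S q]) (F := W [:: x; x'; S q]) (act u).
Proof.
have h1 := mor_comp (mor_rw (W [:: S j]) (mT p)) (mor_vtx u).
exact: (mor_comp (mor_lw x (mor_lw x' (mor_dag_W (mor_vtx u)))) h1).
Qed.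

(** Both sides pair [u] with one transformation [v] made of [T] and [Y], before and after the strand
    i is bent to the right; the two normalisations in [rvtx] cancel the factor d_q / d_p of the
    rotation. *)
Lemma act_adjoint p q i (u : 'I_(N p i q))
    (Y : forall Z, hom (S q \ox Z) (x \ox (x' \ox (S q \ox Z)))) :
  mor (E := W [:: S q]) (F := W [:: x; x'; S q]) Y ->
  scal (dg (act u U) \oc Y U)
  = scal (dg (T p U) \oc ((x |> x' |> dg (rvtx u U))
        \oc (Y (S i^v \ox U) \oc rvtx u U))).
Proof.
move=> hY.
pose v Z : hom (S q \ox Z) (S p \ox (S i \ox Z)) :=
  dg (T p (S i \ox Z)) \oc ((x |> x' |> vtx u Z) \oc Y Z).
have mv : mor (E := W [:: S q]) (F := W [:: S p; S i]) v.
  have h1 := mor_comp (mor_lw x (mor_lw x' (mor_vtx u))) hY.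
  have h2 := mor_dag_W (v := [:: S p]) (w := [:: x; x'; S p]) (mT p).
  exact: (mor_comp (mor_rw (W [:: S i]) h2) h1).
have h := mor_S (mor_comp (mor_dag_W (mor_vtx u)) mv).
set s := scal _ in h; rewrite /= in h.
have -> : scal (dg (act u U) \oc Y U) = s.
  congr scal; rewrite /act /v dag_comp [dg (T _ _ \oc _)]dag_comp.
  by rewrite !lw_dag dagK -!mcompA.
have hv := mor_dag_W mv.
have h' Z : dg (v Z) \oc vtx u Z = s^* *: idm _.
  by have := congr1 dg (h Z); rewrite dag_comp dagK dagZ dag_id.
have := rrot_dotS mv (mor_vtx u) h' U.
move=> /(congr1 dg); rewrite dag_comp dagK dagZ dag_id.
have -> : (s^* * qdim q / qdim p)^* = s * qdim q / qdim p.
  have r0 : (qdim q / qdim p)^* = qdim q / qdim p.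
    by apply/CrealP/ger0_real; rewrite divr_ge0 // ltW ?qdim_gt0.
  by rewrite -mulrA rmorphM /= r0 conjCK mulrA.
move=> e.
have nT := mor_nat (mT p); rewrite /= in nT.
have nT' : (S p |> dg (co i U)) \oc dg (T p (S i \ox (S i^v \ox U)))
    = dg (T p U) \oc (x |> x' |> S p |> dg (co i U)).
  by have := congr1 dg (nT _ _ (co i U)); rewrite !dag_comp !lw_dag.
have e2 : dg (rrot (co i) v U) \oc rrot (co i) (vtx u) U
    = dg (T p U) \oc ((x |> x' |> dg (rrot (co i) (vtx u) U))
        \oc (Y (S i^v \ox U) \oc rrot (co i) (vtx u) U)).
  rewrite [X in dg X]/rrot dag_comp dagK lw_dag /v -!mcompA (comp_eqA nT').
  congr (_ \oc _); rewrite !mcompA; congr (_ \oc _); congr (_ \oc _).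
  by rewrite /rrot dag_comp dagK lw_dag !lw_comp.
have e3 : dg (rrot (co i) v U) \oc rrot (co i) (vtx u) U
    = (s * qdim q / qdim p) *: idm _.
  by rewrite -e dag_comp dagK.
have one : scal (idm (S p \ox U)) = 1 by apply: scal_id; case: (brick_SU p).
rewrite /rvtx dagZ !lwZ !compZr !compZl !compZr -e2 e3 sqrt_ratio_conj.
rewrite !linearZ /= one mulr1 mulrA -expr2 sqrtCK.
by field; rewrite !qdim_neq0.
Qed.

Definition act_sum i q Z := \sum_p \sum_(u : 'I_(N p i q)) act u Z.

Lemma mor_act_sum i q :
  mor (E := W [:: S q]) (F := W [:: x; x'; S q]) (act_sum i q).
Proof.
apply: (@mor_sum R C (W [:: S q]) (W [:: x; x'; S q]) _ _ _
  (fun p Z => \sum_(u : 'I_(N p i q)) act u Z)) => p.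
apply: (@mor_sum R C (W [:: S q]) (W [:: x; x'; S q]) _ _ _
  (fun (u : 'I_(N p i q)) Z => act u Z)) => u.
exact: mor_act.
Qed.

Lemma act_gram i i' :
  \sum_q scal (dg (act_sum i' q U) \oc act_sum i q U)
  = \sum_s (N i i'^v s)%:R *
      \sum_p' \sum_p \sum_(v : 'I_(N p s p')) scal (dg (T p' U) \oc act v U).
Proof.
pose phi p p' (f g : hom (S p' \ox U) (S p \ox (S i \ox (S i'^v \ox U)))) :=
  scal (dg (T p' U) \oc ((x |> x' |> dg f)
     \oc (T p (S i \ox (S i'^v \ox U)) \oc g))).
have phil p p' (J : finType) c (f : J -> _) g :
    @phi p p' (\sum_i c i *: f i) g = \sum_i (c i)^* * phi _ _ (f i) g.
  rewrite /phi dag_sum !lw_sum comp_suml comp_sumr scal_sum.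
  by apply: eq_bigr => k _; rewrite dagZ !lwZ compZl compZr scalZ.
have phir p p' (J : finType) c (f : J -> _) g :
    @phi p p' g (\sum_i c i *: f i) = \sum_i c i * phi _ _ g (f i).
  rewrite /phi !comp_sumr scal_sum.
  by apply: eq_bigr => k _; rewrite !compZr scalZ.
transitivity (\sum_p' \sum_p \sum_q \sum_(u : 'I_(N p i q))
    \sum_(v : 'I_(N p' i' q)) @phi p p' (vtx u _ \oc rvtx v U) (vtx u _ \oc rvtx v U)).
  transitivity (\sum_q \sum_p' \sum_(v : 'I_(N p' i' q))
      \sum_p \sum_(u : 'I_(N p i q))
        @phi p p' (vtx u _ \oc rvtx v U) (vtx u _ \oc rvtx v U)).
    apply: eq_bigr => q _; rewrite {1}/act_sum dag_sum comp_suml scal_sum.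
    apply: eq_bigr => p' _; rewrite dag_sum comp_suml scal_sum.
    apply: eq_bigr => v _; rewrite (act_adjoint v (mor_act_sum i q)).
    rewrite /act_sum comp_suml !comp_sumr scal_sum; apply: eq_bigr => p _.
    rewrite comp_suml !comp_sumr scal_sum; apply: eq_bigr => u _.
    by congr scal; rewrite /act dag_comp !lw_comp -!mcompA.
  rewrite exchange_big; apply: eq_bigr => p' _.
  transitivity (\sum_q \sum_p \sum_(v : 'I_(N p' i' q))
      \sum_(u : 'I_(N p i q)) @phi p p' (vtx u _ \oc rvtx v U) (vtx u _ \oc rvtx v U)).
    by apply: eq_bigr => q _; rewrite exchange_big.
  rewrite exchange_big; apply: eq_bigr => p _.
  by apply: eq_bigr => q _; rewrite exchange_big.
transitivity (\sum_p' \sum_p \sum_s (N i i'^v s)%:R *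
      \sum_(v : 'I_(N p s p')) scal (dg (T p' U) \oc act v U)); last first.
  rewrite (eq_bigr _ (fun p' _ => exchange_big _ _ _ _ _ _)) exchange_big /=.
  apply: eq_bigr => s _; rewrite mulr_sumr; apply: eq_bigr => p' _.
  by rewrite mulr_sumr.
apply: eq_bigr => p' _; apply: eq_bigr => p _.
have := onb_form (w := [:: S p; S i; S i'^v]) (n := p') (phi := @phi p p')
  (onb_comp_l (onb_vtx p i) (fun r => onb_rvtx r i'))
  (onb_comp_r (onb_vtx i i'^v) (fun s => onb_vtx p s)) (phil p p') (phir p p').
rewrite -(sig_big_dep xpredT (fun r => xpredT)
  (fun r (t : 'I_(N p i r) * 'I_(N p' i' r)) =>
     phi p p' (vtx t.1 _ \oc rvtx t.2 U) (vtx t.1 _ \oc rvtx t.2 U))).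
rewrite -(sig_big_dep xpredT (fun s => xpredT)
  (fun s (t : 'I_(N i i'^v s) * 'I_(N p s p')) =>
     phi p p' ((S p |> vtx t.1 _) \oc vtx t.2 U)
              ((S p |> vtx t.1 _) \oc vtx t.2 U))) /=.
move=> e; transitivity (\sum_r \sum_(t : 'I_(N p i r) * 'I_(N p' i' r))
     phi p p' (vtx t.1 _ \oc rvtx t.2 U) (vtx t.1 _ \oc rvtx t.2 U)).
  by apply: eq_bigr => r _; rewrite pair_bigA.
rewrite e; apply: eq_bigr => s _.
rewrite -(pair_bigA _ (fun (u : 'I_(N i i'^v s)) (v : 'I_(N p s p')) =>
     phi p p' ((S p |> vtx u _) \oc vtx v U) ((S p |> vtx u _) \oc vtx v U))) /=.
rewrite exchange_big /= mulr_sumr; apply: eq_bigr => v _.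
(* Naturality of [T] lets [u] slide through and meet its adjoint, so every [u] contributes the same
   and their number is the structure constant. *)
rewrite (eq_bigr (fun=> scal (dg (T p' U) \oc act v U))) => [|u _].
  by rewrite sumr_const card_ord mulr_natl.
have nT := mor_nat (mT p); rewrite /= in nT.
have ee : (x |> x' |> S p |> dg (vtx u U)) \oc (x |> x' |> S p |> vtx u U) = idm _.
  by rewrite -!lw_comp vtx_dot eqxx scale1r !lw_id.
congr scal; congr (_ \oc _).
rewrite /act dag_comp lw_dag [x' |> _]lw_comp [x |> _]lw_comp -!mcompA.
by congr (_ \oc _); rewrite (comp_eqA (nT _ _ _)) (comp_eqA1 ee) mcomp1m.
Qed.

(** The coefficients in s are those of a a^*, so by [act_gram] the sum is the squared norm of the
    vector obtained by letting a act on [T]. *)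
Lemma act_ge0 (a : 'I_m.+1 -> (R[i])%C) :
  0 <= \sum_s (\sum_i \sum_i' a i * (a i')^* * (N i i'^v s)%:R) *
      \sum_p' \sum_p \sum_(v : 'I_(N p s p')) scal (dg (T p' U) \oc act v U).
Proof.
pose Y q := \sum_i a i *: act_sum i q U.
suff -> : \sum_s (\sum_i \sum_i' a i * (a i')^* * (N i i'^v s)%:R) *
      \sum_p' \sum_p \sum_(v : 'I_(N p s p')) scal (dg (T p' U) \oc act v U)
    = \sum_q scal (dg (Y q) \oc Y q).
  by apply: sumr_ge0 => q _; apply/scal_dag_ge0/brick_SU.
transitivity (\sum_i \sum_i' a i * (a i')^* *
    \sum_q scal (dg (act_sum i' q U) \oc act_sum i q U)).
  under eq_bigr do rewrite mulr_suml.
  rewrite exchange_big; apply: eq_bigr => i _.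
  under eq_bigr do rewrite mulr_suml.
  rewrite exchange_big; apply: eq_bigr => i' _.
  rewrite act_gram mulr_sumr; apply: eq_bigr => s _.
  by rewrite mulrA.
transitivity (\sum_i \sum_i' \sum_q a i * (a i')^* *
    scal (dg (act_sum i' q U) \oc act_sum i q U)).
  by apply: eq_bigr => i _; apply: eq_bigr => i' _; rewrite mulr_sumr.
under eq_bigr do rewrite exchange_big.
rewrite exchange_big; apply: eq_bigr => q _ /=.
rewrite /Y dag_sum comp_sumr scal_sum; apply: eq_bigr => i _.
rewrite comp_suml scal_sum; apply: eq_bigr => i' _.
by rewrite dagZ compZr compZl !scalZ mulrA.
Qed.

End PositiveAction.

(** * The vectors that realise the convolution *)

Section SchurVectors.
Variables (p q j : 'I_m.+1) (u : 'I_(N p j q)).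

(* The projection of [S r (x) S p] onto its k-isotypic part, with the source
   strand r bent up to the left. *)
Definition tau r p k Z : hom (S p \ox Z) (S r^v \ox (S r \ox (S p \ox Z))) :=
  (S r^v |> \sum_(a : 'I_(N r p k)) (vtx a Z \oc dg (vtx a Z)))
    \oc dg (ev r (S p \ox Z)).

Lemma mor_proj r p' k : mor (E := W [:: S r; S p']) (F := W [:: S r; S p'])
  (fun Z => \sum_(a : 'I_(N r p' k)) (vtx a Z \oc dg (vtx a Z))).
Proof.
apply: (@mor_sum R C (W [:: S r; S p']) (W [:: S r; S p']) _ _ _
  (fun (a : 'I_(N r p' k)) Z => vtx a Z \oc dg (vtx a Z))) => a.
exact: (mor_comp (mor_vtx a) (mor_dag_W (mor_vtx a))).
Qed.

Lemma mor_tau r p' k :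
  mor (E := W [:: S p']) (F := W [:: S r^v; S r; S p']) (tau r p' k).
Proof.
have hd := mor_dag_W (v := [:: S r^v; S r]) (w := [::]) (ev_mor (dualP r)).
have h := mor_rw (W [:: S p']) hd.
exact: (mor_comp (mor_lw (S r^v) (mor_proj r p' k)) h).
Qed.

(** A recoupling amplitude: its coordinates in the vertices from l to k, j are 6j symbols, but only
    sums of its squared norms get evaluated. *)
Definition gvec r k l (a : 'I_(N r p k)) (b : 'I_(N r q l)) Z :
    hom (S l \ox Z) (S k \ox (S j \ox Z)) :=
  dg (vtx a (S j \ox Z)) \oc ((S r |> vtx u Z) \oc vtx b Z).

(** The strand r, closed on the left, pairs the left rotations of [b] and of the adjoint of K
    applied to [b]; [lrot_dotS] evaluates this with the factor d_l / d_q. *)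
Lemma tau_form r k l :
  scal (dg (tau r q l U) \oc ((S r^v |> S r |> dg (vtx u U))
          \oc (tau r p k (S j \ox U) \oc vtx u U)))
  = qdim l / qdim q * \sum_(b : 'I_(N r q l)) \sum_(a : 'I_(N r p k))
      scal (dg (gvec a b U) \oc gvec a b U).
Proof.
pose K Z : hom (S r \ox (S q \ox Z)) (S r \ox (S q \ox Z)) :=
  (S r |> dg (vtx u Z)) \oc
  ((\sum_(a : 'I_(N r p k)) (vtx a (S j \ox Z) \oc dg (vtx a (S j \ox Z))))
     \oc (S r |> vtx u Z)).
have mK : mor (E := W [:: S r; S q]) (F := W [:: S r; S q]) K.
  have h := mor_comp (mor_rw (W [:: S j]) (mor_proj r p k)) (mor_lw (S r) (mor_vtx u)).
  exact: (mor_comp (mor_lw (S r) (mor_dag_W (mor_vtx u))) h).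
have nev := mor_nat (mor_dag_W (v := [:: S r^v; S r]) (w := [::]) (ev_mor (dualP r))).
rewrite /= in nev.
have e1 : (S r^v |> S r |> dg (vtx u U)) \oc (tau r p k (S j \ox U) \oc vtx u U)
    = (S r^v |> K U) \oc dg (ev r (S q \ox U)).
  rewrite /tau /K -mcompA nev [in RHS]lw_comp [S r^v |> (_ \oc (S r |> _))]lw_comp.
  by rewrite -!mcompA.
rewrite e1 {e1} /tau dag_comp dagK lw_dag dag_sum lw_sum comp_sumr comp_suml.
rewrite scal_sum mulr_sumr.
apply: eq_bigr => b _.
pose v Z := dg (K Z) \oc vtx b Z.
have mv : mor (E := W [:: S l]) (F := W [:: S r; S q]) v.
  have hd := mor_dag_W (v := [:: S r; S q]) (w := [:: S r; S q]) mK.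
  exact: (mor_comp hd (mor_vtx b)).
have hs := mor_S (mor_comp (mor_dag_W mv) (mor_vtx b)).
set s := scal _ in hs; rewrite /= in hs.
transitivity (s * qdim l / qdim q); last first.
  rewrite -mulrA mulrC; congr (_ * _).
  rewrite /s /v dag_comp dagK /K -!mcompA comp_suml !comp_sumr scal_sum.
  apply: eq_bigr => a _; congr scal; rewrite /gvec dag_comp.
  by rewrite [dg (_ \oc vtx b U)]dag_comp dagK lw_dag -!mcompA.
have := lrot_dotS mv (mor_vtx b) hs U.
move=> /(congr1 (@scal _ _ _)).
rewrite scalZ scal_id ?mulr1; last by case: (brick_SU q).
move=> <-; congr scal.
have -> : dg (vtx b U \oc dg (vtx b U)) = vtx b U \oc dg (vtx b U).
  by rewrite dag_comp dagK.
rewrite /lrot [in RHS]dag_comp dagK lw_dag dagK /v [in RHS]dag_comp dagK.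
by rewrite [in LHS]lw_comp [in RHS]lw_comp -!mcompA.
Qed.

(** A snake on p replaces the adjoint of [a] by its right rotation followed by [ev p], and this
    [ev p] bends [u] to the left. Only the rotation of [a] is left, ready for a change of basis. *)
Lemma gvecE r k l (a : 'I_(N r p k)) (b : 'I_(N r q l)) :
  gvec a b U = (S k |> dg (lrot (ev p) (vtx u) U))
    \oc (rrot (co p) (vtx a) (S q \ox U) \oc vtx b U).
Proof.
have mr := mor_nat (mor_rrot (co_mor (dualP p)) (mor_vtx a)); rewrite /= in mr.
have h : dg (vtx a (S j \ox U))
    = (S k |> ev p (S j \ox U)) \oc rrot (co p) (vtx a) (S p \ox (S j \ox U)).
  transitivity (dg (dg (rrot (co p) (vtx a) (S p \ox (S j \ox U)))
      \oc (S k |> dg (ev p (S j \ox U))))).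
    congr dg; have := rrotK (dualP p) (mor_vtx a) (S j \ox U).
    by rewrite {1}/rrot => ->.
  by rewrite dag_comp dagK lw_dag dagK.
have hl : dg (lrot (ev p) (vtx u) U) = ev p (S j \ox U) \oc (S p^v |> vtx u U).
  by rewrite /lrot dag_comp dagK lw_dag dagK.
by rewrite /gvec h hl -mcompA (comp_eqA (mr _ _ _)) [LHS]mcompA -lw_comp.
Qed.

(* In the sum over r, the vertices [a] may be rotated into a basis of
   Hom(S r, S k (x) S p^v), so that [a] and [b] together run over a basis of
   Hom(S l, S k (x) S p^v (x) S q); recoupling the last two strands then leaves
   only the channel j. *)
Lemma gvec_sum k l :
  \sum_r qdim r * \sum_(b : 'I_(N r q l)) \sum_(a : 'I_(N r p k))
      scal (dg (gvec a b U) \oc gvec a b U)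
  = qdim k * (N k j l)%:R * qdim q / qdim j.
Proof.
pose L Z := lrot (ev p) (vtx u) Z.
have mL : mor (E := W [:: S j]) (F := W [:: S p^v; S q]) L.
  exact: (mor_lrot (ev_mor (dualP p)) (mor_vtx u)).
have LL Z : dg (L Z) \oc L Z = (qdim q / qdim j) *: idm _.
  by rewrite (lrot_dotS (mor_vtx u) (mor_vtx u) (vtx_dot u u)) eqxx mul1r.
pose phi (f g : hom (S l \ox U) (S k \ox (S p^v \ox (S q \ox U)))) :=
  scal (dg f \oc ((S k |> (L U \oc dg (L U))) \oc g)).
have phil (J : finType) c (f : J -> _) g :
    phi (\sum_i c i *: f i) g = \sum_i (c i)^* * phi (f i) g.
  rewrite /phi dag_sum comp_suml scal_sum.
  by apply: eq_bigr => i _; rewrite dagZ compZl scalZ.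
have phir (J : finType) c (f : J -> _) g :
    phi g (\sum_i c i *: f i) = \sum_i c i * phi g (f i).
  rewrite /phi !comp_sumr scal_sum.
  by apply: eq_bigr => i _; rewrite !compZr scalZ.
(* [rvtx] carries the square root of d_r / d_k, so the weight d_r is absorbed and d_k comes out:
   this is why the vectors contain d_r^{1/2}. *)
transitivity (qdim k * \sum_r \sum_(a : 'I_(N r p k)) \sum_(b : 'I_(N r q l))
    phi (rvtx a _ \oc vtx b U) (rvtx a _ \oc vtx b U)).
  rewrite mulr_sumr; apply: eq_bigr => r _.
  rewrite exchange_big /= !mulr_sumr; apply: eq_bigr => a _.
  rewrite !mulr_sumr; apply: eq_bigr => b _.
  rewrite gvecE /phi /rvtx !compZl dagZ !compZr compZl !scalZ sqrt_ratio_conj.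
  rewrite [sqrtC _ * (sqrtC _ * _)]mulrA -expr2 sqrtCK.
  rewrite -/(L U) [qdim k * _]mulrA [qdim k * _]mulrC divfK ?qdim_neq0 //.
  congr (_ * scal _); move: (L U) (_ \oc vtx b U) => g y.
  by rewrite dag_comp lw_dag dagK lw_comp !mcompA.
clearbody L.
have := onb_form (w := [:: S k; S p^v; S q]) (n := l) (phi := phi)
  (onb_comp_l (onb_rvtx k p) (fun r => onb_vtx r q))
  (onb_comp_r (onb_vtx p^v q) (fun s => onb_vtx k s)) phil phir.
rewrite -(sig_big_dep xpredT (fun r => xpredT)
  (fun r (t : 'I_(N r p k) * 'I_(N r q l)) =>
     phi (rvtx t.1 _ \oc vtx t.2 U) (rvtx t.1 _ \oc vtx t.2 U))).
rewrite -(sig_big_dep xpredT (fun s => xpredT)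
  (fun s (t : 'I_(N p^v q s) * 'I_(N k s l)) =>
     phi ((S k |> vtx t.1 _) \oc vtx t.2 U) ((S k |> vtx t.1 _) \oc vtx t.2 U))) /=.
move=> e; rewrite -!mulrA; congr (_ * _).
transitivity (\sum_r \sum_(t : 'I_(N r p k) * 'I_(N r q l))
     phi (rvtx t.1 _ \oc vtx t.2 U) (rvtx t.1 _ \oc vtx t.2 U)).
  by apply: eq_bigr => r _; rewrite pair_bigA.
rewrite {}e.
pose c (e : 'I_(N p^v q j)) := scal (dg (vtx e U) \oc L U).
have cE (e : 'I_(N p^v q j)) Z : dg (vtx e Z) \oc L Z = c e *: idm _.
  exact: (mor_S (mor_comp (mor_dag_W (mor_vtx e)) mL)).
have cE' (e : 'I_(N p^v q j)) Z : dg (L Z) \oc vtx e Z = (c e)^* *: idm _.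
  by have := congr1 dg (cE e Z); rewrite dag_comp dagK dagZ dag_id.
have c0 s (e : 'I_(N p^v q s)) Z : s != j -> dg (vtx e Z) \oc L Z = 0.
  rewrite eq_sym => ne; exact: (mor_neq ne (mor_comp (mor_dag_W (mor_vtx e)) mL)).
(* Parseval for [L], whose only channel is j. *)
have cc : \sum_e c e * (c e)^* = qdim q / qdim j.
  have := LL U; move=> /(congr1 (@scal _ _ _)).
  rewrite scalZ scal_id ?mulr1; last by case: (brick_SU j).
  move=> <-; rewrite -[X in dg (L U) \oc X]mcomp1m -vtx_sum.
  rewrite comp_suml comp_sumr (bigD1 j) //= [X in _ + X]big1 ?addr0 => [|s sj].
    rewrite comp_suml comp_sumr scal_sum; apply: eq_bigr => e _.
    rewrite -mcompA cE compZr mcompm1 compZr cE' !scalZ scal_id ?mulr1 //.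
    by case: (brick_SU j).
  rewrite comp_suml big1 ?compm0 // => e _.
  by rewrite -mcompA c0 // compm0.
rewrite (bigD1 j) //= [X in _ + X]big1 ?addr0 => [|s sj]; last first.
  apply: big1 => t _.
  have z : (S k |> dg (vtx t.1 U)) \oc (S k |> (L U \oc dg (L U))) = 0.
    by rewrite -lw_comp mcompA c0 // comp0m lw0.
  rewrite /phi dag_comp lw_dag -mcompA (comp_eqA1 z).
  by rewrite comp0m compm0 -(scale0r (idm _)) scalZ mul0r.
rewrite -cc mulr_sumr.
rewrite -(pair_bigA _ (fun (e : 'I_(N p^v q j)) (v : 'I_(N k j l)) =>
     phi ((S k |> vtx e _) \oc vtx v U) ((S k |> vtx e _) \oc vtx v U))) /=.
apply: eq_bigr => e _.
rewrite (eq_bigr (fun=> c e * (c e)^*)) => [|v _].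
  by rewrite sumr_const card_ord mulr_natl.
have ee : (S k |> dg (vtx e U)) \oc ((S k |> (L U \oc dg (L U))) \oc (S k |> vtx e U))
    = (c e * (c e)^*) *: idm _.
  rewrite -!lw_comp -[X in dg _ \oc X]mcompA cE' compZr mcompm1 compZr cE scalerA.
  by rewrite lwZ lw_id mulrC.
rewrite /phi dag_comp lw_dag -mcompA.
have -> : (S k |> dg (vtx e U))
      \oc ((S k |> (L U \oc dg (L U))) \oc ((S k |> vtx e U) \oc vtx v U))
    = (c e * (c e)^*) *: vtx v U.
  by rewrite [X in _ \oc X]mcompA mcompA ee compZl mcomp1m.
rewrite compZr vtx_dot eqxx scale1r scalZ scal_id ?mulr1 //.
by case: (brick_SU l).
Qed.

End SchurVectors.

Theorem schur_form_ge0 (a b t : 'I_m.+1 -> (R[i])%C) :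
  0 <= \sum_s (\sum_i \sum_i' a i * (a i')^* * (N i i'^v s)%:R) *
      \sum_q \sum_p (t q)^* * t p * (N p s q)%:R *
      ((\sum_k \sum_l (b k)^* * b l * (N k s l)%:R) / qdim s).
Proof.
(* In the product of two coefficients, 1 / d_l cancels the d_l of [tau_form] and 1 / d_k the d_k of
   [gvec_sum]. *)
pose c r p k := t p * sqrtC (qdim r) * ((b k)^* / qdim k).
pose T r p Z := \sum_k c r p k *: tau r p k Z.
have mT r p : mor (E := W [:: S p]) (F := W [:: S r^v; S r; S p]) (T r p).
  apply: (@mor_sum R C (W [:: S p]) (W [:: S r^v; S r; S p]) _ _ _
    (fun k Z => c r p k *: tau r p k Z)) => k.
  exact/mor_scale/mor_tau.
suff -> : \sum_s (\sum_i \sum_i' a i * (a i')^* * (N i i'^v s)%:R) *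
      (\sum_q \sum_p (t q)^* * t p * (N p s q)%:R *
      ((\sum_k \sum_l (b k)^* * b l * (N k s l)%:R) / qdim s))
  = \sum_r \sum_s (\sum_i \sum_i' a i * (a i')^* * (N i i'^v s)%:R) *
      \sum_p' \sum_p \sum_(v : 'I_(N p s p'))
        scal (dg (T r p' U) \oc act (T r) v U).
  by apply: sumr_ge0 => r _; apply: act_ge0.
rewrite [RHS]exchange_big; apply: eq_bigr => s _ /=.
rewrite -[RHS]mulr_sumr; congr (_ * _).
rewrite [RHS]exchange_big; apply: eq_bigr => q _ /=.
rewrite [RHS]exchange_big; apply: eq_bigr => p _ /=.
rewrite [RHS]exchange_big /=.
rewrite [RHS](eq_bigr (fun=> (t q)^* * t p *
  ((\sum_k \sum_l (b k)^* * b l * (N k s l)%:R) / qdim s))) => [|u _].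
  by rewrite sumr_const card_ord -[RHS]mulr_natl mulrAC mulrC.
transitivity (\sum_k \sum_l (t q)^* * t p * ((b l * (b k)^*) / (qdim k * qdim q)) *
   \sum_r qdim r * \sum_(y : 'I_(N r q l)) \sum_(x : 'I_(N r p k))
      scal (dg (gvec u x y U) \oc gvec u x y U)); last first.
  rewrite mulr_suml mulr_sumr; apply: eq_bigr => k _.
  rewrite mulr_suml mulr_sumr; apply: eq_bigr => l _.
  rewrite gvec_sum; field.
  by rewrite !qdim_neq0.
transitivity (\sum_r \sum_k \sum_l (c r q l)^* * c r p k * (qdim l / qdim q) *
   \sum_(y : 'I_(N r q l)) \sum_(x : 'I_(N r p k))
      scal (dg (gvec u x y U) \oc gvec u x y U)); last first.
  rewrite (eq_bigr _ (fun r _ => exchange_big _ _ _ _ _ _)) exchange_big /=.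
  rewrite [RHS]exchange_big /=; apply: eq_bigr => l _.
  rewrite exchange_big /=; apply: eq_bigr => k _.
  rewrite mulr_sumr; apply: eq_bigr => r _; rewrite [in RHS]mulrA.
  congr (_ * _); rewrite /c rmorphM rmorphM rmorphM /= fmorphV /= conjCK.
  have rs : (sqrtC (qdim r))^* = sqrtC (qdim r).
    by apply/CrealP/ger0_real; rewrite sqrtC_ge0 ltW ?qdim_gt0.
  have rd : (qdim l)^* = qdim l by apply/CrealP/gtr0_real/qdim_gt0.
  rewrite rs rd -[X in _ = _ * X]sqrtCK.
  by field; rewrite !qdim_neq0.
apply: eq_bigr => r _.
transitivity (\sum_k \sum_l (c r q l)^* * c r p k *
   scal (dg (tau r q l U) \oc ((S r^v |> S r |> dg (vtx u U))
          \oc (tau r p k (S s \ox U) \oc vtx u U)))); last first.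
  by apply: eq_bigr => k _; apply: eq_bigr => l _; rewrite tau_form mulrA.
have eT : T r p (S s \ox U) \oc vtx u U
    = \sum_k c r p k *: (tau r p k (S s \ox U) \oc vtx u U).
  by rewrite /T comp_suml; apply: eq_bigr => k _; rewrite compZl.
rewrite /act eT !comp_sumr scal_sum; apply: eq_bigr => k _.
rewrite /T dag_sum comp_suml scal_sum; apply: eq_bigr => l _.
by rewrite dagZ compZl !compZr !scalZ mulrA.
Qed.

End FusionCategory.

(** * Positive square roots of matrices *)

Section SquareRoot.
Variables (K : numClosedFieldType) (n : nat).
Local Open Scope sesquilinear_scope.

(** The last clause is what later makes the root a multiplication operator. In a spectral basis of
    [A], a matrix commuting with it has zero entries wherever two eigenvalues differ, so it commutes
    with their square roots too. *)
Lemma psd_sqrtmx (A : 'M[K]_n) :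
  A ^t* = A -> (forall v : 'rV_n, 0 <= (v *m A *m v ^t*) 0 0) ->
  exists B : 'M[K]_n, [/\ B ^t* = B, B *m B = A
    & forall L, L *m A = A *m L -> L *m B = B *m L].
Proof.
move=> Ah Ap.
have /orthomx_spectralP : A \is normalmx by apply/normalmxP; rewrite Ah.
set P := spectralmx A; set s := spectral_diag A => Ae.
have Pu : P \is unitarymx by exact: spectral_unitarymx.
have PP : P *m P ^t* = 1%:M by apply/unitarymxP.
have PP' : P ^t* *m P = 1%:M by apply: mulmx1C.
rewrite invmx_unitary // in Ae.
have s0 i : 0 <= s 0 i.
  have := Ap (delta_mx 0 i *m P).
  rewrite trmx_mul map_mxM /=.
  set e := delta_mx 0 i; set e' := (e ^t*)%sesqui.
  have -> : e *m P *m A *m (P ^t* *m e') = e *m diag_mx s *m e'.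
    by rewrite [in LHS]Ae !mulmxA -(mulmxA e) PP mulmx1 -(mulmxA _ P) PP mulmx1.
  rewrite -rowE mxE (bigD1 i) //= big1 => [|k ki].
    by rewrite !mxE !eqxx rmorph1 mulr1 mulr1n addr0.
  by rewrite !mxE eq_sym (negbTE ki) mulr0n mul0r.
pose t := \row_i sqrtC (s 0 i).
have ts : diag_mx t *m diag_mx t = diag_mx s.
  rewrite mulmx_diag; congr diag_mx; apply/rowP => i.
  by rewrite !mxE -expr2 sqrtCK.
exists (P ^t* *m diag_mx t *m P); split.
- rewrite !trmx_mul !map_mxM /= map_trmx trmxK -map_mx_comp mulmxA.
  rewrite (map_mx_id (@conjCK K)) tr_diag_mx map_diag_mx; congr (_ *m diag_mx _ *m _).
  apply/rowP => i; rewrite !mxE; apply/CrealP/ger0_real.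
  by rewrite sqrtC_ge0.
- by rewrite [RHS]Ae -ts !mulmxA -(mulmxA _ P) PP mulmx1.
move=> L LA.
pose L' := P *m L *m P ^t*.
have LE : L = P ^t* *m L' *m P.
  by rewrite /L' !mulmxA PP' mul1mx -mulmxA PP' mulmx1.
have Ls : L' *m diag_mx s = diag_mx s *m L'.
  have := congr1 (fun X => P *m X *m P ^t*) LA.
  rewrite Ae /L' !mulmxA PP mul1mx => e.
  by rewrite -[RHS]e -(mulmxA _ P) PP mulmx1.
clearbody L'.
have Lt : L' *m diag_mx t = diag_mx t *m L'.
  apply/matrixP => i j; have /matrixP /(_ i j) := Ls.
  rewrite !mul_mx_diag !mul_diag_mx !mxE.
  have [->|ne] := eqVneq (s 0 i) (s 0 j); first by move=> _; rewrite mulrC.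
  rewrite [RHS]mulrC => /eqP; rewrite -subr_eq0 -mulrBr mulf_eq0 subr_eq0.
  by rewrite [s 0 j == _]eq_sym (negbTE ne) orbF => /eqP ->; rewrite mul0r mulr0.
by rewrite LE !mulmxA -!(mulmxA _ P) !PP !mulmx1 -!(mulmxA (P ^t*)) Lt.
Qed.

End SquareRoot.

(** * Schur's test for the operator norm *)

Section OperatorNorm.
Variables (R : realType) (m : nat) (N : 'I_m.+1 -> 'I_m.+1 -> nat).
Variables (d : 'I_m.+1 -> R) (c : R).
Hypotheses (d0 : forall k, 0 < d k)
  (rowN : forall s, \sum_k (N k s)%:R * d k = c * d s)
  (colN : forall k, \sum_s (N k s)%:R * d s = c * d k).

(** Cauchy-Schwarz with the weights N_{ks} d_k for each s, then summation over s. As [d] is a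
    positive eigenvector on both sides, each of the two steps costs one factor c. *)
Lemma schur_test (r : 'I_m.+1 -> R) :
  \sum_s (\sum_k (N k s)%:R * r k) ^+ 2 <= c ^+ 2 * \sum_k r k ^+ 2.
Proof.
have row s : (\sum_k (N k s)%:R * r k) ^+ 2
    <= c * d s * \sum_k (N k s)%:R * (r k ^+ 2 / d k).
  have := rowN s; move: (c * d s) => A rowA.
  set B := \sum_k _; set Q := \sum_k _.
  have A0 : 0 <= A.
    by rewrite -rowA sumr_ge0 // => k _; rewrite mulr_ge0 ?ler0n // ltW.
  have [Az|Anz] := eqVneq A 0.
    suff -> : B = 0 by rewrite expr0n Az mul0r.
    apply: big1 => k _.
    move: (rowA); rewrite Az => /eqP; rewrite psumr_eq0; last first.
      by move=> k' _; rewrite mulr_ge0 ?ler0n // ltW.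
    move=> /allP /(_ k (mem_index_enum _)); rewrite /= mulf_eq0.
    by rewrite (gt_eqF (d0 k)) orbF => /eqP ->; rewrite mul0r.
  have Ap : 0 < A by rewrite lt0r Anz.
  (* Cauchy-Schwarz as a variance: B / A is the mean of r_k / d_k for the weights N_{ks} d_k, of
     total mass A. *)
  have h : 0 <= \sum_k (N k s)%:R * d k * (r k / d k - B / (A)) ^+ 2.
    by apply: sumr_ge0 => k _; rewrite mulr_ge0 ?sqr_ge0 // mulr_ge0 ?ler0n // ltW.
  have e : \sum_k (N k s)%:R * d k * (r k / d k - B / (A)) ^+ 2
      = Q - B ^+ 2 / (A).
    transitivity (Q - 2 * (B / (A)) * (\sum_k (N k s)%:R * r k)
        + (B / (A)) ^+ 2 * (\sum_k (N k s)%:R * d k)).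
      rewrite !mulr_sumr -sumrB -big_split /=; apply: eq_bigr => k _.
      by field; rewrite Anz lt0r_neq0.
    by rewrite rowA -/B; field.
  by move: h; rewrite e subr_ge0 ler_pdivrMr // mulrC.
apply: le_trans (ler_sum _ (fun s _ => row s)) _.
under eq_bigr do rewrite mulr_sumr.
rewrite exchange_big mulr_sumr; apply: ler_sum => k _ /=.
rewrite (eq_bigr (fun s => (N k s)%:R * d s * (c * (r k ^+ 2 / d k))))
  => [|s _]; last by ring.
rewrite -mulr_suml colN le_eqVlt; apply/orP; left; apply/eqP.
by field; exact/lt0r_neq0.
Qed.

End OperatorNorm.

Section ComplexCoordinates.
Variable R : realType.
Implicit Types z : (R[i])%C.

Lemma Re_sum I (r : seq I) (P : pred I) (F : I -> (R[i])%C) :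
  complex.Re (\sum_(i <- r | P i) F i) = \sum_(i <- r | P i) complex.Re (F i).
Proof. by apply: (big_morph (@complex.Re R)) => [[a b] [c d]|]. Qed.

Lemma Im_sum I (r : seq I) (P : pred I) (F : I -> (R[i])%C) :
  complex.Im (\sum_(i <- r | P i) F i) = \sum_(i <- r | P i) complex.Im (F i).
Proof. by apply: (big_morph (@complex.Im R)) => [[a b] [c d]|]. Qed.

Lemma Re_natM n z : complex.Re (z * n%:R) = n%:R * complex.Re z.
Proof.
rewrite -(rmorph_nat (real_complex R)); case: z => a b.
by rewrite /= mulr0 subr0 mulrC.
Qed.

Lemma Im_natM n z : complex.Im (z * n%:R) = n%:R * complex.Im z.
Proof.
rewrite -(rmorph_nat (real_complex R)); case: z => a b.
by rewrite /= mulr0 add0r mulrC.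
Qed.

Lemma Re_conjM z : complex.Re (z^* * z) = complex.Re z ^+ 2 + complex.Im z ^+ 2.
Proof. by case: z => a b; rewrite /= mulNr opprK !expr2. Qed.

End ComplexCoordinates.

(** * The fusion algebra: dimension, convolution and positivity *)

Section FusionRing.
Variables (R : realType) (m : nat) (G : fusionData m).
Variable d : 'I_m.+1 -> (R[i])%C.
Local Notation N := (fcoef G).
Local Notation "j ^v" := (fdual G j) (at level 2, format "j ^v").
Local Notation V := 'rV[(R[i])%C]_m.+1.
Hypothesis fcoefA : forall p i k n,
  (\sum_r N p i r * N r k n = \sum_s N i k s * N p s n)%N.
Hypothesis fcoef_frob : forall n j q, N n j q = N q j^v n.
Hypothesis fcoef0l : forall j s, N ord0 j s = (s == j).
Hypothesis fcoef0r : forall j s, N j ord0 s = (s == j).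
Hypothesis d_gt0 : forall j, 0 < d j.
Hypothesis dM : forall p j, d p * d j = \sum_q (N p j q)%:R * d q.
Implicit Types (i j k p q r s n : 'I_m.+1) (x y z w : V).

Lemma fdualK j : j^v^v = j.
Proof.
have := fcoef_frob ord0 j j; rewrite [in RHS]fcoef_frob !fcoef0l eqxx.
by case: eqP.
Qed.

Lemma fcoef_r0 i j : N i j ord0 = (i == j^v).
Proof. by rewrite fcoef_frob fcoef0l. Qed.

(** Both are the multiplicity of the unit in x_p x_j x_{q^*}. *)
Lemma fcoef_rot p j q : N p j q = N j q^v p^v.
Proof.
have := fcoefA p j q^v ord0.
rewrite (bigD1 q) //= big1 => [|r rq]; last first.
  by rewrite fcoef_r0 fdualK (negbTE rq) muln0.
rewrite fcoef_r0 fdualK eqxx muln1 addn0 => ->.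
rewrite (bigD1 p^v) //= big1 => [|s sp]; last first.
  rewrite fcoef_r0 (_ : (p == s^v) = false) ?muln0 //.
  by apply: contra_neqF sp => /eqP ->; rewrite fdualK.
by rewrite fcoef_r0 fdualK eqxx muln1 addn0.
Qed.

Lemma fcoef_frobl p j q : N p j q = N p^v q j.
Proof. by rewrite [RHS]fcoef_rot fdualK -fcoef_frob. Qed.

Lemma d_conj j : (d j)^* = d j.
Proof. by apply/CrealP/gtr0_real. Qed.

(** After multiplication by the sum of the d_p^2, both sides expand to the same double sum over p
    and q, transposed by Frobenius reciprocity. *)
Lemma d_dual j : d j^v = d j.
Proof.
have s0 : \sum_p d p * d p != 0.
  rewrite gt_eqF // (bigD1 ord0) //=; apply: ltr_pwDl; first exact: mulr_gt0.
  by apply: sumr_ge0 => p _; rewrite ltW // mulr_gt0.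
apply: (mulfI s0); rewrite !mulr_suml.
transitivity (\sum_q d q * (d q * d j^v)).
  by apply: eq_bigr => q _; rewrite mulrA.
transitivity (\sum_p d p * (d p * d j)); last first.
  by apply: eq_bigr => q _; rewrite mulrA.
under eq_bigr do rewrite dM mulr_sumr.
under [RHS]eq_bigr do rewrite dM mulr_sumr.
rewrite exchange_big; apply: eq_bigr => p _; apply: eq_bigr => q _.
by rewrite -fcoef_frob; ring.
Qed.

Lemma starBE x s : starB G x 0 s = (x 0 s^v)^*.
Proof.
rewrite mxE (big_pred1 s^v) // => j; apply/eqP/eqP => [<-|->];
  by rewrite fdualK.
Qed.

Lemma mulBE x y s :
  mulB G x y 0 s = \sum_j \sum_k x 0 j * y 0 k * (N j k s)%:R.
Proof. by rewrite mxE. Qed.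

Lemma posB_coef z s : mulB G (starB G z) z 0 s
  = \sum_k \sum_l (z 0 k)^* * z 0 l * (N k s l)%:R.
Proof.
rewrite mulBE (reindex_inj (can_inj fdualK)); apply: eq_bigr => k _.
by apply: eq_bigr => l _; rewrite starBE fdualK -fcoef_frobl.
Qed.

(** [schur_form_ge0] takes its two factors in different forms: y as b^* b, by [posB_coef], and x as
    a a^*, where a is the adjoint of the witness z. *)
Lemma posB_coef_r z s : mulB G (starB G z) z 0 s
  = \sum_i \sum_i' starB G z 0 i * (starB G z 0 i')^* * (N i i'^v s)%:R.
Proof.
rewrite mulBE; apply: eq_bigr => i _.
rewrite (reindex_inj (can_inj fdualK)); apply: eq_bigr => i' _.
by rewrite [starB G z 0 i']starBE conjCK.
Qed.

Lemma posB_dual x s : posB G x -> (x 0 s)^* = x 0 s^v.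
Proof.
move=> [z ->]; rewrite !posB_coef rmorph_sum /=.
under eq_bigr do rewrite rmorph_sum /=.
rewrite exchange_big; apply: eq_bigr => k _; apply: eq_bigr => l _ /=.
by rewrite !rmorphM /= conjCK rmorph_nat fcoef_frob; ring.
Qed.

Local Notation dR := (fun j => complex.Re (d j)).

Lemma dRE j : ((dR j)%:C)%C = d j.
Proof. by rewrite RRe_real // gtr0_real. Qed.

Lemma dR_gt0 j : 0 < dR j.
Proof. by have := d_gt0 j; rewrite ltcE => /andP[]. Qed.

Lemma dRM p j : dR p * dR j = \sum_q (N p j q)%:R * dR q.
Proof.
apply: (@complexI R); rewrite rmorphM rmorph_sum /= !dRE dM.
by apply: eq_bigr => q _; rewrite rmorphM /= dRE rmorph_nat.
Qed.

Lemma normL2E y : normL2 G y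
  = Num.sqrt (\sum_k complex.Re (y 0 k) ^+ 2 + \sum_k complex.Im (y 0 k) ^+ 2).
Proof.
rewrite /normL2 /tauB posB_coef -big_split Re_sum; congr Num.sqrt.
apply: eq_bigr => k _; rewrite (bigD1 k) //= big1 ?addr0 => [|l lk].
  by rewrite fcoef0r eqxx mulr1 Re_conjM.
by rewrite fcoef0r (negbTE lk) mulr0.
Qed.

Lemma mulB_fbasis j y s :
  mulB G (fbasis R j) y 0 s = \sum_k y 0 k * (N j k s)%:R.
Proof.
rewrite mulBE (bigD1 j) //= [X in _ + X]big1 ?addr0 => [|i ij].
  by apply: eq_bigr => k _; rewrite mxE !eqxx mul1r.
by apply: big1 => k _; rewrite mxE eqxx (negbTE ij) !mul0r.
Qed.

(** The vector d is a positive eigenvector of left multiplication by x_j and of its transpose, with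
    eigenvalue d_j: Schur's test bounds the norm by d_j, and d itself, normalised, attains it. *)
Lemma opnorm_fbasis j : opnorm G (fbasis R j) = dR j.
Proof.
have col k : \sum_s (N j k s)%:R * dR s = dR j * dR k by rewrite dRM.
have row s : \sum_k (N j k s)%:R * dR k = dR j * dR s.
  have -> : dR j = dR j^v by rewrite d_dual.
  by rewrite dRM; apply: eq_bigr => k _; rewrite fcoef_frobl.
have ub y : normL2 G (mulB G (fbasis R j) y) <= dR j * normL2 G y.
  rewrite -[X in X * _](ger0_norm (ltW (dR_gt0 j))) -sqrtr_sqr !normL2E.
  rewrite -sqrtrM ?sqr_ge0 //.
  rewrite ler_wsqrtr // mulrDr; apply: lerD.
    under eq_bigr do rewrite mulB_fbasis Re_sum.
    under eq_bigr do under eq_bigr do rewrite Re_natM.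
    exact: (schur_test dR_gt0 row col).
  under eq_bigr do rewrite mulB_fbasis Im_sum.
  under eq_bigr do under eq_bigr do rewrite Im_natM.
  exact: (schur_test dR_gt0 row col).
pose D := Num.sqrt (\sum_k dR k ^+ 2).
have D0 : 0 < D.
  rewrite sqrtr_gt0 (bigD1 ord0) //=; apply: ltr_pwDl.
    by rewrite exprn_gt0 // dR_gt0.
  by apply: sumr_ge0 => k _; rewrite sqr_ge0.
pose y : V := \row_k ((dR k / D)%:C)%C.
have nrm (c : R) (v : V) : 0 <= c -> (forall k, v 0 k = ((c * (dR k / D))%:C)%C) ->
    normL2 G v = c.
  move=> c0 hv; rewrite normL2E [X in _ + X]big1 ?addr0 => [|k _]; last first.
    by rewrite hv expr0n.
  rewrite (eq_bigr (fun k => dR k ^+ 2 * (c / D) ^+ 2)) => [|k _]; last first.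
    by rewrite hv /=; field; exact/lt0r_neq0.
  rewrite -mulr_suml sqrtrM ?sumr_ge0 // => [|k _]; last exact: sqr_ge0.
  rewrite -/D sqrtr_sqr (ger0_norm (divr_ge0 c0 (ltW D0))).
  by rewrite mulrC divfK // gt_eqF.
have ny : normL2 G y = 1 by apply: nrm => // k; rewrite mxE mul1r.
have nby : normL2 G (mulB G (fbasis R j) y) = dR j.
  apply: nrm => [|s]; first by rewrite ltW ?dR_gt0.
  rewrite mulB_fbasis mulrA -row mulr_suml rmorph_sum; apply: eq_bigr => k _ /=.
  by rewrite mxE -(rmorph_nat (real_complex R)) -rmorphM /=; congr (_%:C)%C; ring.
have hub : has_ubound [set normL2 G (mulB G (fbasis R j) y)
    | y in [set y : V | normL2 G y <= 1]]%classic.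
  exists (dR j) => _ [v hv <-]; apply: le_trans (ub v) _.
  by rewrite ler_piMr // ltW ?dR_gt0.
apply/eqP; rewrite eq_le; apply/andP; split.
  apply: ge_sup.
    by exists (normL2 G (mulB G (fbasis R j) y)), y => //=; rewrite ny.
  move=> _ [v hv <-]; apply: le_trans (ub v) _.
  by rewrite ler_piMr // ltW ?dR_gt0.
by apply: (ub_le_sup hub); exists y => //=; rewrite ny.
Qed.

Lemma fpdim_fbasis j : fpdim G (fbasis R j) = d j.
Proof.
rewrite /fpdim (bigD1 j) //= big1 ?addr0 => [|k kj].
  by rewrite mxE !eqxx mul1r opnorm_fbasis dRE.
by rewrite mxE eqxx (negbTE kj) mul0r.
Qed.

Lemma convBE x y s : convB G x y 0 s = x 0 s * y 0 s / d s.
Proof.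
rewrite /convB /fourier /fourier_inv starBE mxE fpdim_fbasis !starBE !fdualK.
rewrite !rmorphM /= fmorphV /= !conjCK d_conj d_dual.
by ring.
Qed.

Local Open Scope sesquilinear_scope.

(** The form is that of [rm w], right multiplication by w. Its root B commutes with every left
    multiplication [lm y], so it is right multiplication by z, the image of the unit; then z is
    self-adjoint and z z = w. *)
Lemma psd_posB w : (forall s, (w 0 s)^* = w 0 s^v) ->
  (forall t : 'I_m.+1 -> (R[i])%C,
     0 <= \sum_s \sum_q \sum_p (t q)^* * t p * (N p s q)%:R * w 0 s) ->
  posB G w.
Proof.
move=> wd wp.
pose rm w : 'M[(R[i])%C]_m.+1 := \matrix_(p, q) \sum_s w 0 s * (N p s q)%:R.
pose lm y : 'M[(R[i])%C]_m.+1 := \matrix_(p, q) \sum_j y 0 j * (N j p q)%:R.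
have rmE v u : v *m rm u = mulB G v u.
  apply/rowP => q; rewrite mulBE mxE; apply: eq_bigr => p _.
  rewrite mxE mulr_sumr; apply: eq_bigr => s _.
  by rewrite mulrA.
have lmE v u : v *m lm u = mulB G u v.
  apply/rowP => q; rewrite mulBE mxE exchange_big; apply: eq_bigr => p _ /=.
  rewrite mxE mulr_sumr; apply: eq_bigr => s _.
  by ring.
have comm y u : lm y *m rm u = rm u *m lm y.
  apply/matrixP => k s; rewrite !mxE.
  transitivity (\sum_j \sum_t y 0 j * u 0 t * (\sum_r N j k r * N r t s)%:R).
    transitivity (\sum_r \sum_j \sum_t y 0 j * u 0 t * (N j k r * N r t s)%:R).
      apply: eq_bigr => r _; rewrite !mxE mulr_suml; apply: eq_bigr => j _.
      by rewrite mulr_sumr; apply: eq_bigr => t _; rewrite natrM; ring.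
    rewrite exchange_big; apply: eq_bigr => j _ /=.
    rewrite exchange_big; apply: eq_bigr => t _ /=.
    by rewrite natr_sum mulr_sumr.
  transitivity (\sum_r \sum_j \sum_t
      y 0 j * u 0 t * (N k t r * N j r s)%:R); last first.
    apply: eq_bigr => r _; rewrite !mxE mulr_suml exchange_big.
    apply: eq_bigr => t _ /=.
    by rewrite mulr_sumr; apply: eq_bigr => j _; rewrite natrM; ring.
  rewrite [RHS]exchange_big; apply: eq_bigr => j _ /=.
  rewrite [RHS]exchange_big; apply: eq_bigr => t _ /=.
  by rewrite fcoefA natr_sum mulr_sumr.
have hA : (rm w) ^t* = rm w.
  apply/matrixP => p q; rewrite !mxE rmorph_sum (reindex_inj (can_inj fdualK)) /=.
  apply: eq_bigr => s _; rewrite rmorphM /= rmorph_nat wd fdualK.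
  by rewrite -fcoef_frob.
have pA (v : V) : 0 <= (v *m rm w *m v ^t*) 0 0.
  have := wp (fun p => v 0 p); congr (0 <= _).
  rewrite mxE exchange_big; apply: eq_bigr => q _ /=.
  rewrite !mxE mulr_suml exchange_big; apply: eq_bigr => p _ /=.
  by rewrite mxE mulr_sumr mulr_suml; apply: eq_bigr => s _; ring.
have [B [hB BB BL]] := psd_sqrtmx hA pA.
pose e0 : V := delta_mx 0 ord0.
have e0r v : mulB G v e0 = v.
  rewrite -lmE; apply/rowP => q; rewrite mxE (bigD1 ord0) //= big1 ?addr0 => [|p p0].
    rewrite mxE eqxx mul1r mxE (bigD1 q) //= big1 ?addr0 => [|k kq].
      by rewrite fcoef0r eqxx mulr1.
    by rewrite fcoef0r eq_sym (negbTE kq) mulr0.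
  by rewrite mxE (negbTE p0) andbF mul0r.
have e0l v : mulB G e0 v = v.
  rewrite -rmE; apply/rowP => q; rewrite mxE (bigD1 ord0) //= big1 ?addr0 => [|p p0].
    rewrite mxE eqxx mul1r mxE (bigD1 q) //= big1 ?addr0 => [|k kq].
      by rewrite fcoef0l eqxx mulr1.
    by rewrite fcoef0l eq_sym (negbTE kq) mulr0.
  by rewrite mxE (negbTE p0) andbF mul0r.
pose z := e0 *m B.
have zE : z = e0 *m B by [].
have zB s : z 0 s = B ord0 s by rewrite zE -rowE mxE.
clearbody z.
have Bz v : v *m B = mulB G v z.
  by rewrite -{1}(e0r v) -lmE -mulmxA BL ?comm // mulmxA lmE zE.
exists z.
have -> : starB G z = z.
  apply/rowP => s; rewrite starBE.
  rewrite zB; have := congr1 (fun X : 'M_m.+1 => X s^v ord0) hB; rewrite /= !mxE => ->.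
  have -> : B s^v ord0 = (delta_mx 0 s^v *m B : V) 0 ord0 by rewrite -rowE mxE.
  rewrite Bz mulBE (bigD1 s^v) //= [X in _ + X]big1 ?addr0 => [|i ij]; last first.
    by apply: big1 => k _; rewrite mxE (negbTE ij) andbF !mul0r.
  rewrite (bigD1 s) //= big1 ?addr0 => [|k ks].
    by rewrite mxE !eqxx mul1r fcoef_r0 eqxx mulr1.
  rewrite fcoef_r0 (inj_eq (can_inj fdualK)) eq_sym (negbTE ks).
  by rewrite mulr0.
by rewrite -Bz {1}zE -mulmxA BB rmE e0l.
Qed.

End FusionRing.

Theorem proposition7p6 (R : realType) (C : unitaryFusionCategory R) (m : nat)
    (X : 'I_m.+1 -> C) (G : fusionData m)
    (hG : is_grothendieck_ring X G)
    (x y : 'rV[(R[i])%C]_m.+1) :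
  posB G x -> posB G y -> posB G (convB G x y).
Proof.
move=> px py.
have A := fcoefA hG; have F := fcoef_frob hG.
have l := fcoef0l hG; have r := fcoef0r hG.
have d0 := qdim_gt0 hG; have dM := qdimM hG.
have wE := convBE A F l r d0 dM x y.
apply: (psd_posB A F l r) => [s|t].
  rewrite !wE !rmorphM /= fmorphV /= (posB_dual A F l s px) (posB_dual A F l s py).
  by rewrite (d_conj d0) (d_dual F d0 dM).
have [a xE] := px; have [b yE] := py.
have := schur_form_ge0 hG (fun i => starB G a 0 i) (fun k => b 0 k) t.
congr (0 <= _); apply: eq_bigr => s _.
rewrite mulr_sumr; apply: eq_bigr => q _.
rewrite mulr_sumr; apply: eq_bigr => p _.
rewrite wE xE yE (posB_coef_r F l) (posB_coef A F l).
by ring.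
Qed.
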